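(* Let $d\geq 1$ be an integer, let $p\geq 2$ be a real number, and let $\{\varepsilon_{\boldsymbol{i}},\boldsymbol{i}\in\mathbb{Z}^d\}$ be an i.i.d. set of real random variables. Then for any measurable function $f\colon\mathbb{R}^{\mathbb{Z}^d}\to\mathbb{R}$ such that $X_{\boldsymbol{j}}:=f\left((\varepsilon_{\boldsymbol{j}-\boldsymbol{i}})_{\boldsymbol{i}\in\mathbb{Z}^d}\right)$ has a finite moment of order $p$ and is centered, and any $(a_{\boldsymbol{i}})_{\boldsymbol{i}\in\mathbb{Z}^d}\in\ell^2(\mathbb{Z}^d)$, $$\left\lVert\sum_{\boldsymbol{i}\in\mathbb{Z}^d}a_{\boldsymbol{i}}X_{\boldsymbol{i}}\right\rVert_p\leq\frac{14.5p}{\log p}\left(\sum_{\boldsymbol{i}\in\mathbb{Z}^d}a_{\boldsymbol{i}}^2\right)^{1/2}\sum_{j=0}^{+\infty}(4j+4)^{d/2}\lVert X_{\boldsymbol{0},j}\rVert_2+\frac{14.5p}{\log p}\left(\sum_{\boldsymbol{i}\in\mathbb{Z}^d}|a_{\boldsymbol{i}}|^p\right)^{1/p}\sum_{j=0}^{+\infty}(4j+4)^{d(1-1/p)}\lVert X_{\boldsymbol{0},j}\rVert_p,$$ where for $j\geq 1$, $$X_{\boldsymbol{0},j}=\mathbb{E}\left[X_{\boldsymbol{0}}\mid\sigma\{\varepsilon_{\boldsymbol{u}},\lVert\boldsymbol{u}\rVert_\infty\leq j\}\right]-\mathbb{E}\left[X_{\boldsymbol{0}}\mid\sigma\{\varepsilon_{\boldsymbol{u}},\lVert\boldsymbol{u}\rVert_\infty\leq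 j-1\}\right]$$ and $X_{\boldsymbol{0},0}=\mathbb{E}[X_{\boldsymbol{0}}\mid\sigma\{\varepsilon_{\boldsymbol{0}}\}]$.
   Context: For a random variable $Y$ and $q\geq 1$, $\lVert Y\rVert_q:=(\mathbb{E}[|Y|^q])^{1/q}$. For $\boldsymbol{i}=(i_1,\dots,i_d)\in\mathbb{Z}^d$, $\lVert\boldsymbol{i}\rVert_\infty:=\max_{1\leq q\leq d}|i_q|$, and $\boldsymbol{0}=(0,\dots,0)$. For $q\geq 1$, $\ell^q(\mathbb{Z}^d)$ is the space of real families $\boldsymbol{a}=(a_{\boldsymbol{i}})_{\boldsymbol{i}\in\mathbb{Z}^d}$ with $\left(\sum_{\boldsymbol{i}\in\mathbb{Z}^d}|a_{\boldsymbol{i}}|^q\right)^{1/q}<+\infty$. For a random field $(Y_{\boldsymbol{i}})_{\boldsymbol{i}\in\mathbb{Z}^d}$, the sum $\sum_{\boldsymbol{i}\in\mathbb{Z}^d}Y_{\boldsymbol{i}}$ is understood as the $\mathbb{L}^1$-limit, as $k\to\infty$, of $\sum_{\boldsymbol{i}\in\mathbb{Z}^d,\lVert\boldsymbol{i}\rVert_\infty\leq k}Y_{\boldsymbol{i}}$. *)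

(* Defs.v *)
From mathcomp Require Import all_boot all_order all_algebra.
From mathcomp Require Import finmap.
From mathcomp Require Import all_classical all_reals all_analysis.

Set Implicit Arguments.
Unset Strict Implicit.
Unset Printing Implicit Defensive.

Import Order.TTheory GRing.Theory Num.Theory.
Import numFieldNormedType.Exports.

Local Open Scope classical_set_scope.
Local Open Scope ring_scope.

(* The lattice Z^d is 'rV[int]_d. *)
Definition supnorm (d : nat) (i : 'rV[int]_d) : nat :=
  \max_(q < d) absz (i ord0 q).

Definition box (d k : nat) : set 'rV[int]_d :=
  [set i | (supnorm i <= k)%N].

(* \sum_(i \in A) is 0 by convention on infinite supports; boxes are finite,
   so the sums over boxes below are the genuine ones. *)
Lemma finite_box (d k : nat) : finite_set (@box d k).
Proof.
pose g (v : {ffun 'I_d -> 'I_(k.*2.+1)}) : 'rV[int]_d :=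
  \row_q ((v q : nat)%:Z - k%:Z).
apply: (@sub_finite_set _ _ (g @` setT)); last first.
  by apply: finite_image; exact: finite_finset.
move=> i /= hi.
exists [ffun q => inord (absz (i ord0 q + k%:Z))] => //.
apply/rowP => q; rewrite !mxE ffunE.
have hq : (absz (i ord0 q) <= k)%N.
  by apply: leq_trans hi; exact: (leq_bigmax (F := fun q => absz (i ord0 q))).
have hq' : `|i ord0 q| <= k%:Z by rewrite -abszE lez_nat.
move: hq'; rewrite ler_norml => /andP[h1 h2].
have h0 : 0 <= i ord0 q + k%:Z by rewrite -lerBlDr sub0r.
rewrite inordK; first by rewrite gez0_abs// addrK.
rewrite ltnS -lez_nat gez0_abs// -addnn PoszD lerD2r//.
Qed.

(* The product sigma-algebra on R^I, generated by the coordinate maps. *)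
Definition coordinate_sets (I : Type) (R : realType) : set (set (I -> R)) :=
  \bigcup_(i in [set: I])
    preimage_set_system setT (fun x : I -> R => x i) measurable.

Section probability.
Context (disp : measure_display) (Omega : measurableType disp) (R : realType).
Variable P : probability Omega R.

Definition mutually_independent (I : choiceType) (Y : I -> {RV P >-> R}) :=
  forall (J : {fset I}) (B : I -> set R),
    (forall i, measurable (B i)) ->
    P (\bigcap_(i in [set` J]) (Y i @^-1` B i))
      = (\prod_(i <- J) P (Y i @^-1` B i))%E.

(* Equality of laws is required on measurable sets only: the function
   underlying [distribution] also takes (irrelevant) values elsewhere. *)
Definition identically_distributed (I : Type) (Y : I -> {RV P >-> R}) :=
  forall (i j : I) (B : set R), measurable B ->
    distribution P (Y i) B = distribution P (Y j) B.

Definition iid (I : choiceType) (Y : I -> {RV P >-> R}) :=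
  mutually_independent Y /\ identically_distributed Y.

Definition sigma_of (I : Type) (Y : I -> Omega -> R) (A : set I) :
    set (set Omega) :=
  <<s \bigcup_(i in A) preimage_set_system setT (Y i) measurable >>.

(* Y is a version of E[X | F]; F is meant to be a sub-sigma-algebra of the
   measurable sets of Omega, and X to be integrable. *)
Definition is_cond_exp (F : set (set Omega)) (X Y : Omega -> R) :=
  [/\ forall B : set R, measurable B -> F (Y @^-1` B),
      P.-integrable setT (EFin \o Y) &
      forall A, F A ->
        (\int[P]_(w in A) (Y w)%:E = \int[P]_(w in A) (X w)%:E)%E].

(* S is (a version of) the sum of the random field Y. *)
Definition is_L1_sum (d : nat) (Y : 'rV[int]_d -> Omega -> R)
    (S : Omega -> R) :=
  P.-integrable setT (EFin \o S) /\
  (fun k : nat =>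
     'N[P]_1[(fun w => (\sum_(i \in @box d k) Y i w - S w)%R%:E)])%E
    @ \oo --> (0 : \bar R)%E.

End probability.

Definition shift_field (Omega : Type) (R : realType) (d : nat)
    (eps : 'rV[int]_d -> Omega -> R) (f : ('rV[int]_d -> R) -> R)
    (j : 'rV[int]_d) (w : Omega) : R :=
  f (fun i => eps (j - i) w).

(* When Y j is a version of E[X_0 | eps_u, |u| <= j], this is X_{0,j};
   for j = 0 the box is {0}, so that Y 0 is a version of E[X_0 | eps_0]. *)
Definition projection_increment (Omega : Type) (R : realType)
    (Y : nat -> Omega -> R) (j : nat) (w : Omega) : R :=
  if j is j'.+1 then Y j w - Y j' w else Y 0%N w.

(* (sum_i |a_i|^q)^(1/q), as an extended real. *)
Definition lnorm (I : choiceType) (R : realType) (q : R) (a : I -> R) :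
    \bar R :=
  ((\esum_(i in [set: I]) (`|a i| `^ q)%:E) `^ q^-1)%E.

(* Main.v *)
(** Writing X_{i,j} for the j-th increment of X_i along the sigma-algebras of
the boxes centred at i, X_i is the L1 limit of the partial sums of the X_{i,j}.
At level j, X_{i,j} only depends on the innovations in a box of side 2j+1
centred at i, so the lattice splits into (2j+1)^d residue classes modulo 2j+1
along each of which the X_{i,j} are independent.  Rosenthal's inequality is
applied to every class; Minkowski's inequality and the power mean inequality
over the classes produce the factors (2j+1)^(d/2) and (2j+1)^(d(1-1/p)).

Rosenthal's inequality with a constant of order p / ln p comes from the
potential V(u) = (1 + u^2)^(p/2): a second-order expansion gives
V(u + x) <= V(u) + V'(u) x + V(u) psi(x) with
psi(x) = p (p - 1) x^2 (1 + |x|)^(p-2), so that adding an independent centred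
variable X multiplies E V(S) by at most 1 + E psi(X).  It remains to bound
psi(x) by a combination of x^2 and |x|^p and to rescale the sum by
10 (p / ln p) (sigma + M). *)
From HB Require Import structures.
Require Import Defs.
From mathcomp Require Import all_boot all_order all_algebra.
From mathcomp Require Import finmap ring lra zify.
From mathcomp Require Import all_classical all_reals all_analysis.
From mathcomp Require Import measurable_realfun.

Set Implicit Arguments.
Unset Strict Implicit.
Unset Printing Implicit Defensive.

Import Order.TTheory GRing.Theory Num.Theory.
Import numFieldNormedType.Exports.

Local Open Scope classical_set_scope.
Local Open Scope ring_scope.

(** * The bracket potential *)

(** Only versions [Y j] of the conditional expectations at the site 0 are given. They are factored
    through the coordinates of the path, so every increment becomes a function on path space, and
    the X_{i,j} at the other sites are obtained by translating these functions; no conditional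
    expectation is taken away from 0. Independence and stationarity then reduce to statements about
    cylinders. All limits are taken in L1: convexity lets bounds on p-norms pass to L1 limits, so
    neither the martingale step nor the passage from boxes to the whole lattice uses convergence in
    L^p. The same finite-sum bound, applied to the difference of two boxes, gives existence of the
    sum, since tails in l^p are controlled by tails in l^2. Constants: the scale 10 (p / ln p) makes
    the exponent at most p / 5, so the moment method gives 10 exp(1/5) (p / ln p), and exp(1/5) <=
    5/4 leaves room below 14.5. Likewise 2j+1 is simply enlarged to 4j+4. *)

Section real_inequalities.
Context {R : realType}.
Implicit Types p q r t u v x y : R.

(** The sign of [x] is left free so that the same form serves for an increment and then for the
    distance [c - u] to the intermediate point it produced. *)
Lemma mean_value_around (F f : R -> R) u x :
  (forall v, is_derive v 1 F (f v)) ->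
  exists2 c, `|c - u| <= `|x| & F (u + x) - F u = f c * x.
Proof.
move=> Ff.
have cF : continuous F.
  by move=> v; apply/differentiable_continuous/derivable1_diffP; case: (Ff v).
have [x0|x0|->] := ltgtP x 0.
- have [c] := @MVT_segment _ F f (u + x) u ltac:(lra) (fun v _ => Ff v)
    (continuous_subspaceT cF).
  rewrite in_itv/= => /andP[c1 c2] cE.
  exists c; first by rewrite !ler0_norm; lra.
  by rewrite -opprB cE; ring.
- have [c] := @MVT_segment _ F f u (u + x) ltac:(lra) (fun v _ => Ff v)
    (continuous_subspaceT cF).
  rewrite in_itv/= => /andP[c1 c2] cE.
  exists c; first by rewrite !ger0_norm; lra.
  by rewrite cE; ring.
- by exists u; [rewrite subrr normr0|rewrite addr0 subrr mulr0].
Qed.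

Lemma powRDp x u v : 0 < x -> x `^ (u + v) = x `^ u * x `^ v.
Proof. by move=> x0; rewrite powRD// (gt_eqF x0) implybT. Qed.

(** A convex function lies above its tangents. This is the only convexity used: it yields the power
    mean inequality, the comparison of the 1-norm with the p-norm, and the passage of p-norm bounds
    to L1 limits. *)
Lemma powR_tangent q x y : 1 <= q -> 0 <= x -> 0 <= y ->
  y `^ q + q * y `^ (q - 1) * (x - y) <= x `^ q.
Proof.
move=> q1 x0 y0.
have q0 : q != 0 by lra.
have [->|yn0] := eqVneq y 0.
  rewrite powR0// add0r subr0.
  (* Since 0 to the power 0 is 1, the tangent at 0 has slope 1 when [q] is 1 and slope 0
     otherwise. *)
  have [->|qn1] := eqVneq q 1; first by rewrite subrr powRr0 powRr1// mul1r mul1r.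
  by rewrite powR0 ?subr_eq0// mulr0 mul0r powR_ge0.
have {yn0} yp : 0 < y by rewrite lt_neqAle eq_sym yn0.
have yE : y `^ q = y `^ (q - 1) * y.
  by rewrite -[X in _ * X](powRr1 y0) -powRDp ?subrK.
have [xE|xn0] := eqVneq x 0.
  rewrite xE sub0r yE powR0//.
  have : 0 <= (q - 1) * (y `^ (q - 1) * y).
    by rewrite !mulr_ge0 ?powR_ge0// subr_ge0.
  lra.
have {xn0} xp : 0 < x by rewrite lt_neqAle eq_sym xn0.
have der v : 0 < v -> is_derive v 1 (@powR R ^~ q) (q * v `^ (q - 1)).
  by move=> v0; exact: is_derive1_powR.
have cont a b : 0 < a -> {within `[a, b], continuous (@powR R ^~ q)}.
  move=> a0; apply: continuous_in_subspaceT => v.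
  rewrite inE/= in_itv/= => /andP[av _].
  apply/differentiable_continuous/derivable1_diffP.
  by case: (der v (lt_le_trans a0 av)).
have [xy|yx] := leP x y.
- have [|c] := @MVT_segment _ (@powR R ^~ q) (fun v => q * v `^ (q - 1)) x y xy _
    (cont _ _ xp).
    by move=> v; rewrite in_itv/= => /andP[xv _]; apply: der; lra.
  rewrite in_itv/= => /andP[xc cy] cE.
  have h : c `^ (q - 1) <= y `^ (q - 1) by apply: ge0_ler_powR; rewrite ?nnegrE; lra.
  have : 0 <= q * (y `^ (q - 1) - c `^ (q - 1)) * (y - x).
    by rewrite !mulr_ge0 ?subr_ge0//; lra.
  lra.
- have [|c] := @MVT_segment _ (@powR R ^~ q) (fun v => q * v `^ (q - 1)) y x (ltW yx) _
    (cont _ _ yp).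
    by move=> v; rewrite in_itv/= => /andP[xv _]; apply: der; lra.
  rewrite in_itv/= => /andP[xc cy] cE.
  have h : y `^ (q - 1) <= c `^ (q - 1) by apply: ge0_ler_powR; rewrite ?nnegrE; lra.
  have : 0 <= q * (c `^ (q - 1) - y `^ (q - 1)) * (x - y).
    by rewrite !mulr_ge0 ?subr_ge0 ?(ltW yx)//; lra.
  lra.
Qed.

(** Summing the tangent inequalities taken at the mean [m] cancels the linear terms, which is
    Jensen's inequality for the uniform weights. *)
Lemma power_mean (I : finType) q (x : I -> R) : 1 <= q -> (forall i, 0 <= x i) ->
  (0 < #|I|)%N ->
  (\sum_i x i) <= #|I|%:R `^ (1 - q^-1) * (\sum_i x i `^ q) `^ q^-1.
Proof.
move=> q1 x0 I0; set N : R := #|I|%:R.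
have N0 : 0 < N by rewrite ltr0n.
pose m := (\sum_i x i) / N.
have m0 : 0 <= m by rewrite divr_ge0 ?sumr_ge0// ltW.
have mE : \sum_i x i = N * m by rewrite /m mulrC divfK ?gt_eqF.
have : N * m `^ q <= \sum_i x i `^ q.
  apply: (@le_trans _ _ (\sum_i (m `^ q + q * m `^ (q - 1) * (x i - m)))).
    rewrite big_split/= -mulr_sumr sumrB mE !sumr_const.
    by rewrite -(mulr_natl m) -(mulr_natl (m `^ q)) subrr mulr0 addr0.
  by apply: ler_sum => i _; exact: powR_tangent.
move=> h.
have qp : 0 < q by lra.
have : (N * m `^ q) `^ q^-1 <= (\sum_i x i `^ q) `^ q^-1.
  apply: ge0_ler_powR; rewrite ?nnegrE ?invr_ge0 ?(ltW qp)//.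
    by rewrite mulr_ge0 ?powR_ge0// ltW.
  by rewrite sumr_ge0// => i _; rewrite powR_ge0.
rewrite powRM ?powR_ge0 ?(ltW N0)// -powRrM mulfV ?gt_eqF// powRr1// => h2.
rewrite mE.
have -> : N * m = N `^ (1 - q^-1) * (N `^ q^-1 * m).
  by rewrite mulrA -powRD ?subrK ?powRr1 ?(ltW N0)// (gt_eqF N0) implybT.
by rewrite ler_wpM2l// powR_ge0.
Qed.

(** A smooth substitute for |u|^p: it dominates |u|^p, equals 1 at 0, and stays at least 1, so a
    Taylor remainder can be absorbed as a multiple of the potential itself. *)
Definition bracket_pow p u : R := (1 + u ^+ 2) `^ (p / 2).
Definition bracket_pow' p u : R := p * u * (1 + u ^+ 2) `^ (p / 2 - 1).
Definition bracket_pow'' p u : R :=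
  p * (1 + u ^+ 2) `^ (p / 2 - 1)
  + p * (p - 2) * u ^+ 2 * (1 + u ^+ 2) `^ (p / 2 - 2).

Lemma bracket_gt0 u : 0 < 1 + u ^+ 2.
Proof. by nra. Qed.

Lemma is_derive_bracket r u :
  is_derive u 1 (fun v => (1 + v ^+ 2) `^ r) (r * (1 + u ^+ 2) `^ (r - 1) * (2 * u)).
Proof.
have h1 : is_derive (u : R) 1 (fun v : R => 1 + v ^+ 2) (2 * u).
  apply: is_derive_eq; rewrite add0r /= /GRing.scale/=; ring.
have := @is_derive1_comp _ (fun a : R => a `^ r) (fun v : R => 1 + v ^+ 2) u
  (r * (1 + u ^+ 2) `^ (r - 1)) (2 * u)
  (@is_derive1_powR R r (1 + u ^+ 2) (bracket_gt0 u)) h1.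
by [].
Qed.

Lemma is_derive_bracket_pow p u : is_derive u 1 (bracket_pow p) (bracket_pow' p u).
Proof.
have h := is_derive_bracket (p / 2) u.
have -> : bracket_pow' p u = p / 2 * (1 + u ^+ 2) `^ (p / 2 - 1) * (2 * u).
  by rewrite /bracket_pow'; field.
exact: h.
Qed.

Lemma is_derive_bracket_pow' p u :
  is_derive u 1 (bracket_pow' p) (bracket_pow'' p u).
Proof.
have h1 : is_derive u 1 (fun v => p * v) p.
  by apply: is_derive_eq; rewrite scaler1.
have h2 := is_derive_bracket (p / 2 - 1) u.
have h := @is_deriveM _ _ (fun v => p * v) (fun v => (1 + v ^+ 2) `^ (p / 2 - 1)) u 1 _ _ h1 h2.
apply: is_derive_eq.
rewrite /bracket_pow'' /GRing.scale/=.
rewrite (_ : p / 2 - 1 - 1 = p / 2 - 2); last by ring.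
by field.
Qed.

(** After the common power is factored out, what remains is (1 + u^2) + (p - 2) u^2 <= (p - 1) (1 +
    u^2). *)
Lemma norm_bracket_pow'' p u : 2 <= p ->
  `|bracket_pow'' p u| <= p * (p - 1) * (1 + u ^+ 2) `^ (p / 2 - 1).
Proof.
move=> p2; have u0 := bracket_gt0 u.
have -> : bracket_pow'' p u =
    p * (1 + u ^+ 2) `^ (p / 2 - 2) * ((1 + u ^+ 2) + (p - 2) * u ^+ 2).
  rewrite /bracket_pow'' (_ : p / 2 - 1 = p / 2 - 2 + 1); last by ring.
  by rewrite powRDp// powRr1 ?ltW//; ring.
rewrite ger0_norm; last first.
  rewrite !mulr_ge0 ?powR_ge0//; first by lra.
  nra.
rewrite (_ : p / 2 - 1 = p / 2 - 2 + 1); last by ring.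
rewrite (@powRDp _ (p / 2 - 2) 1 u0) powRr1 ?(ltW u0)//.
have := powR_ge0 (1 + u ^+ 2) (p / 2 - 2); set w := _ `^ _ => w0.
have pw : 0 <= p * w by rewrite mulr_ge0//; lra.
rewrite (_ : p * (p - 1) * _ = p * w * ((p - 1) * (1 + u ^+ 2))); last by ring.
rewrite ler_wpM2l//; nra.
Qed.

Definition taylor_rem p x : R := p * (p - 1) * (x ^+ 2 * (1 + `|x|) `^ (p - 2)).

Lemma taylor_rem_ge0 p x : 2 <= p -> 0 <= taylor_rem p x.
Proof.
move=> p2; have h : 0 <= p * (p - 1) by nra.
by rewrite /taylor_rem mulr_ge0// mulr_ge0 ?powR_ge0 ?sqr_ge0.
Qed.

(* The mean value theorem is used twice, for V and for V', which costs a factor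
   2 against Taylor's formula but keeps a single derivative bound. *)
Lemma bracket_pow_taylor p u x : 2 <= p ->
  bracket_pow p (u + x) <=
  bracket_pow p u + bracket_pow' p u * x + bracket_pow p u * taylor_rem p x.
Proof.
move=> p2.
have [c cu cE] := @mean_value_around _ _ u x (is_derive_bracket_pow p).
have [e ec eE] := @mean_value_around _ _ u (c - u) (is_derive_bracket_pow' p).
rewrite subrKC in eE.
have eu : `|e - u| <= `|x| by exact: le_trans cu.
have {}eE : bracket_pow' p c * x - bracket_pow' p u * x =
    bracket_pow'' p e * ((c - u) * x) by rewrite -mulrBl eE mulrA.
suff : bracket_pow'' p e * ((c - u) * x) <= bracket_pow p u * taylor_rem p x.
  lra.
apply: le_trans (ler_norm _) _; rewrite !normrM.
have h1 := norm_bracket_pow'' e p2.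
have bu := bracket_gt0 u; have be := bracket_gt0 e.
(* Since e is within |x| of u, 1 + e^2 <= (1 + u^2) (1 + |x|)^2. Raising this to p/2 - 1 >= 0 gives
   the power p - 2 of 1 + |x|, and the power of 1 + u^2 is then enlarged to p/2. *)
have h2 : (1 + e ^+ 2) `^ (p / 2 - 1) <=
    bracket_pow p u * (1 + `|x|) `^ (p - 2).
  apply: (@le_trans _ _ (((1 + u ^+ 2) * (1 + `|x|) ^+ 2) `^ (p / 2 - 1))).
    apply: ge0_ler_powR; rewrite ?nnegrE; [lra|exact: ltW| |].
      by rewrite mulr_ge0 ?sqr_ge0// ltW.
    have : `|e| <= `|u| + `|x|.
      by rewrite -(subrKC u e) (le_trans (ler_normD _ _))// lerD2l.
    rewrite -(real_normK (num_real e)) -(real_normK (num_real u)).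
    move: (normr_ge0 e) (normr_ge0 u) (normr_ge0 x).
    move: `|e| `|u| `|x| => {}e {eE h1 be bu cE eu ec}v y e0 v0 y0 evy.
    apply: (@le_trans _ _ (1 + (v + y) ^+ 2)); first by rewrite lerD2l; nra.
    have : v <= 1 + v ^+ 2 by nra.
    have : 0 <= y ^+ 2 * v ^+ 2 by rewrite mulr_ge0 ?sqr_ge0.
    nra.
  rewrite powRM ?(ltW bu) ?sqr_ge0//; apply: ler_pM; rewrite ?powR_ge0//.
    apply: ler_powR; first by nra.
    lra.
  rewrite -powR_mulrn ?addr_ge0// -powRrM (_ : 2%:R * (p / 2 - 1) = p - 2)//; by field.
rewrite /taylor_rem.
have h3 : `|c - u| * `|x| <= x ^+ 2.
  by rewrite -(real_normK (num_real x)) expr2 ler_wpM2r.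
have h4 : 0 <= p * (p - 1) by nra.
rewrite (_ : _ * (p * (p - 1) * _) = p * (p - 1) *
  (bracket_pow p u * (1 + `|x|) `^ (p - 2)) * x ^+ 2); last by ring.
apply: ler_pM; rewrite ?mulr_ge0//.
by apply: (le_trans h1); rewrite ler_wpM2l.
Qed.

(** Below the threshold [t], 1 + |x| is at most 1 + t and the quadratic term suffices; above it, 1 +
    |x| is at most (1 + 1/t) |x| and the p-th power suffices. *)
Lemma taylor_rem_split p t x : 2 <= p -> 0 < t ->
  taylor_rem p x <= p * (p - 1) *
    ((1 + t) `^ (p - 2) * x ^+ 2 + (1 + t^-1) `^ (p - 2) * `|x| `^ p).
Proof.
move=> p2 t0; rewrite /taylor_rem ler_wpM2l//; first by nra.
have t'0 : 0 < t^-1 by rewrite invr_gt0.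
have [xt|tx] := leP `|x| t.
  rewrite -[leLHS]addr0 lerD ?mulr_ge0 ?powR_ge0// mulrC ler_wpM2r ?sqr_ge0//.
  by have := normr_ge0 x; move=> ?; apply: ge0_ler_powR; rewrite ?nnegrE; lra.
rewrite -[leLHS]add0r lerD ?(mulr_ge0 (powR_ge0 _ _) (sqr_ge0 _))//.
have x0 : 0 < `|x| by apply: lt_trans tx.
rewrite (_ : `|x| `^ p = `|x| `^ (p - 2) * x ^+ 2); last first.
  rewrite -(real_normK (num_real x)) -[in RHS]powR_mulrn// -powRD ?subrK//.
  by rewrite (gt_eqF x0) implybT.
rewrite mulrC mulrA ler_wpM2r ?sqr_ge0// -powRM ?addr_ge0 ?(ltW t'0)//.
apply: ge0_ler_powR; rewrite ?nnegrE; [lra|lra|by rewrite mulr_ge0//; lra|].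
rewrite mulrDl mul1r addrC lerD2l ler_pdivlMl//; lra.
Qed.

Lemma ln_le_powR r x : 0 < r -> 0 < x -> ln x <= r^-1 * x `^ r.
Proof.
move=> r0 x0; have xr0 := powR_gt0 r x0.
rewrite ler_pdivlMl// -ln_powR.
exact/ltW/ln_sublinear.
Qed.

(** From exp(-1/5) >= 4/5 one gets exp(1/5) <= 5/4, so the left side is in fact at most 12.5. *)
Lemma exp_fifth_le : 10 * expR (5^-1) <= 145 / 10 :> R.
Proof.
have h := @expR_ge1Dx R (- 5^-1).
have e0 := expR_gt0 (5^-1 : R).
have : expR (5^-1 : R) * expR (- 5^-1) = 1 by rewrite -expRD subrr expR0.
nra.
Qed.

Lemma ln_gt0_ge2 p : 2 <= p -> 0 < ln p.
Proof. by move=> p2; apply: ln_gt0; lra. Qed.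

(* The threshold ln p / (2 p) balances the two terms: the first power is at most
   exp (ln p / 2) = sqrt p, the base of the second one is of order p / ln p and
   is compensated by the scale t. *)
Lemma rosenthal_exponent p t u v : 2 <= p -> 0 < t -> 0 <= u -> 0 <= v ->
  10 * p / ln p * u <= t -> 10 * p / ln p * v <= t ->
  p * (p - 1) * ((1 + ln p / (2 * p)) `^ (p - 2) * (u / t) ^+ 2 +
     (1 + (ln p / (2 * p))^-1) `^ (p - 2) * (v / t) `^ p) <= p * 5^-1.
Proof.
move=> p2 t0 u0 v0 ut vt.
have p0 : 0 < p by lra.
have L0 := ln_gt0_ge2 p2.
set L := ln p in L0 ut vt *.
have small w : 0 <= w -> 10 * p / L * w <= t -> 0 <= w / t <= L / (10 * p).
  move=> w0 wt; rewrite divr_ge0 ?(ltW t0)//= ler_pdivrMr// mulrAC.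
  rewrite ler_pdivlMr; last by lra.
  move: wt; rewrite mulrAC ler_pdivrMr//; lra.
have /andP[ut0 uts] := small u u0 ut.
have /andP[vt0 vts] := small v v0 vt.
have pq : p `^ 2^-1 * p `^ 2^-1 = p.
  by rewrite -powRDp// (_ : _ + _ = 1) ?powRr1 ?(ltW p0)//; field.
(* The exponent 1/2 gives L^2 <= 4 p for the second term; the exponent 1/4 gives L^2 <= 16 sqrt p
   for the first, which already carries a factor sqrt p. *)
have L2p : L <= 2 * p `^ 2^-1.
  have := @ln_le_powR 2^-1 p; rewrite invrK; apply=> //; lra.
have L4p : L <= 4 * p `^ 4^-1.
  have := @ln_le_powR 4^-1 p; rewrite invrK; apply=> //; lra.
have q4 : p `^ 4^-1 * p `^ 4^-1 = p `^ 2^-1.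
  by rewrite -powRDp//; congr (_ `^ _); field.
have q40 := powR_gt0 4^-1 p0.
have q20 := powR_gt0 2^-1 p0.
have D0 : 0 < L / (2 * p) by rewrite divr_gt0//; lra.
have hD : (1 + L / (2 * p)) `^ (p - 2) <= p `^ 2^-1.
  apply: (@le_trans _ _ ((1 + L / (2 * p)) `^ p)).
    by apply: ler_powR; lra.
  apply: (@le_trans _ _ (expR (L / (2 * p)) `^ p)).
    apply: ge0_ler_powR; rewrite ?nnegrE ?expR_ge0 ?expR_ge1Dx//; lra.
  rewrite -expRM /powR gt_eqF// ler_expR -/L.
  by rewrite le_eqVlt; apply/orP; left; apply/eqP; field; rewrite gt_eqF.
have -> : p * (p - 1) * ((1 + L / (2 * p)) `^ (p - 2) * (u / t) ^+ 2 +
     (1 + (L / (2 * p))^-1) `^ (p - 2) * (v / t) `^ p) =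
     p * (p - 1) * ((1 + L / (2 * p)) `^ (p - 2) * (u / t) ^+ 2) +
     p * (p - 1) * ((1 + (L / (2 * p))^-1) `^ (p - 2) * (v / t) `^ p) by ring.
have pp1 : 0 <= p * (p - 1) by nra.
have pp2 : p * (p - 1) <= p ^+ 2 by nra.
have LL : (L / (10 * p)) ^+ 2 = L ^+ 2 / (100 * p ^+ 2).
  by field; rewrite gt_eqF.
(* The budget p / 5 is divided into 16/100 for the quadratic term and 4/100 for the term of order
   p. *)
have h1 : p * (p - 1) * ((1 + L / (2 * p)) `^ (p - 2) * (u / t) ^+ 2) <=
    16 / 100 * p.
  apply: (@le_trans _ _ (p ^+ 2 * (p `^ 2^-1 * (L / (10 * p)) ^+ 2))).
    apply: ler_pM => //; first by rewrite mulr_ge0 ?powR_ge0 ?sqr_ge0.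
    by apply: ler_pM; rewrite ?powR_ge0 ?sqr_ge0// ler_sqr ?nnegrE// (le_trans ut0).
  rewrite LL (_ : p ^+ 2 * _ = p `^ 2^-1 * L ^+ 2 / 100); last by field; rewrite gt_eqF.
  have : L ^+ 2 <= 16 * p `^ 2^-1 by nra.
  nra.
have h2 : p * (p - 1) * ((1 + (L / (2 * p))^-1) `^ (p - 2) * (v / t) `^ p) <=
    4 / 100 * p.
  apply: (@le_trans _ _ (p ^+ 2 * (L / (10 * p)) ^+ 2)).
    (* Two of the p powers of L / (10 p) are set aside to cancel p^2. The other p - 2 are paired
       with 1 + 2p/L; the product of the bases is L / (10 p) + 1/5, hence at most 1. *)
    apply: ler_pM => //; first by rewrite mulr_ge0 ?powR_ge0.
    have s0 : 0 < L / (10 * p) by rewrite divr_gt0//; lra.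
    apply: (@le_trans _ _ ((1 + (L / (2 * p))^-1) `^ (p - 2) * (L / (10 * p)) `^ p)).
      rewrite ler_wpM2l ?powR_ge0//.
      by apply: ge0_ler_powR; rewrite ?nnegrE//; lra.
    have -> : (L / (10 * p)) `^ p = (L / (10 * p)) `^ (p - 2) * (L / (10 * p)) ^+ 2.
      by rewrite -[in RHS]powR_mulrn ?(ltW s0)// -powRDp// subrK.
    rewrite mulrA -powRM ?(ltW s0)//; last first.
      by rewrite addr_ge0 ?invr_ge0 ?(ltW D0).
    rewrite -[leRHS]mul1r ler_wpM2r ?sqr_ge0//.
    have Lp : L <= p by apply: ltW; exact: ln_sublinear.
    have h : (1 + (L / (2 * p))^-1) * (L / (10 * p)) <= 1.
      rewrite (_ : (1 + (L / (2 * p))^-1) * (L / (10 * p)) = (L / p) / 10 + 5^-1); last first.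
        by field; rewrite !gt_eqF.
      have : L / p <= 1 by rewrite ler_pdivrMr// mul1r.
      lra.
    have one : 1 `^ (p - 2) = 1 :> R by rewrite powR1.
    rewrite -[leRHS]one; apply: ge0_ler_powR; rewrite ?nnegrE//; first by lra.
    by rewrite mulr_ge0 ?addr_ge0 ?invr_ge0 ?(ltW s0) ?(ltW D0).
  rewrite LL (_ : p ^+ 2 * _ = L ^+ 2 / 100); last by field; rewrite gt_eqF.
  have : L ^+ 2 <= 4 * p by nra.
  nra.
lra.
Qed.

End real_inequalities.

(** * Rosenthal's inequality *)

Section rosenthal.
Context (disp : measure_display) (Omega : measurableType disp) (R : realType).
Variable P : probability Omega R.
Implicit Types p q s t u v x y c : R.

Definition independent_pair (S X : Omega -> R) :=
  forall A B : set R, measurable A -> measurable B ->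
    P (S @^-1` A `&` X @^-1` B) = (P (S @^-1` A) * P (X @^-1` B))%E.

(** Independence says that the joint law agrees with the product of the marginals on rectangles,
    hence everywhere; Tonelli's theorem then separates the variables. *)
Lemma independent_integral (S X : {RV P >-> R}) (F : R * R -> \bar R) :
  independent_pair S X -> measurable_fun setT F -> (forall z, (0 <= F z)%E) ->
  (\int[P]_w F (S w, X w) = \int[P]_w \int[P]_w' F (S w, X w'))%E.
Proof.
move=> SX mF F0.
have mSX : measurable_fun setT (fun w => (S w, X w)).
  by apply/measurable_fun_pairP; split; exact: measurable_funP.
pose SXm := isMeasurableFun.Build _ _ _ _ _ mSX.
pose Z : {mfun Omega >-> (R * R)%type} := HB.pack (fun w => (S w, X w)) SXm.
rewrite (_ : (\int[P]_w F (S w, X w))%E = (\int[P]_w (F \o Z) w)%E)//.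
rewrite -(@ge0_integral_distribution _ _ _ _ _ P Z F)//.
rewrite (@eq_measure_integral _ _ _ _ (distribution P S \x distribution P X)%E); last first.
  move=> A mA _; apply/esym; exact: product_measure_unique.
rewrite fubini_tonelli1//.
rewrite ge0_integral_distribution//=.
- apply: eq_integral => w _ /=.
  rewrite /fubini_F ge0_integral_distribution//.
  exact: measurableT_comp.
- exact: measurable_fun_fubini_tonelli_F.
- by move=> x; apply: integral_ge0.
Qed.

Lemma measurable_bracket_pow p : measurable_fun setT (@bracket_pow R p).
Proof.
apply: (@measurableT_comp _ _ _ _ _ _ (@powR R ^~ (p / 2))) => //.
by apply: measurable_funD => //; exact: measurable_funX.
Qed.

Lemma measurable_taylor_rem p : measurable_fun setT (@taylor_rem R p).
Proof.
apply: measurable_funM => //; apply: measurable_funM; first exact: measurable_funX.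
apply: (@measurableT_comp _ _ _ _ _ _ (@powR R ^~ (p - 2))) => //.
by apply: measurable_funD => //; exact: measurableT_comp.
Qed.

(** With [s] frozen, the first-order term integrates to 0 because X is centred. Freezing [s] first
    means that nothing has to be known about the moments of S when it is later replaced by an
    independent variable. *)
Lemma integral_bracket_pow_add_cst p (s c : R) (X : {RV P >-> R}) : 2 <= p ->
  P.-integrable setT (EFin \o X) -> (\int[P]_w (X w)%:E = 0)%E ->
  (\int[P]_w (taylor_rem p (X w))%:E <= c%:E)%E ->
  (\int[P]_w (bracket_pow p (s + X w))%:E <= (bracket_pow p s * (1 + c))%:E)%E.
Proof.
move=> p2 iX X0 Xc.
have mX : measurable_fun setT X by exact: measurable_funP.
have V0 u : 0 <= bracket_pow p u by exact: powR_ge0.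
have mr : measurable_fun setT (fun w => taylor_rem p (X w)).
  exact: (measurableT_comp (@measurable_taylor_rem p)).
have ir : P.-integrable setT (fun w => (taylor_rem p (X w))%:E).
  apply/integrableP; split; first exact/measurable_EFinP.
  under eq_integral do rewrite gee0_abs ?lee_fin ?taylor_rem_ge0//.
  by rewrite (le_lt_trans Xc)// ltry.
pose G w := ((bracket_pow p s)%:E + ((bracket_pow' p s)%:E * (X w)%:E +
   (bracket_pow p s)%:E * (taylor_rem p (X w))%:E))%E.
apply: (@le_trans _ _ (\int[P]_w G w)%E).
  have le w : ((bracket_pow p (s + X w))%:E <= G w)%E.
    by rewrite /G -!EFinM -!EFinD lee_fin addrA; exact: bracket_pow_taylor.
  apply: ge0_le_integral => //.
  - by move=> w _; rewrite lee_fin.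
  - apply/measurable_EFinP.
    apply: (measurableT_comp (@measurable_bracket_pow p)).
    exact: measurable_funD.
  - apply/measurable_EFinP; apply: measurable_funD => //.
    by apply: measurable_funD; exact: measurable_funM.
have i1 : P.-integrable setT (fun w => (bracket_pow' p s)%:E * (X w)%:E)%E.
  exact: integrableZl.
have i2 : P.-integrable setT (fun w => (bracket_pow p s)%:E * (taylor_rem p (X w))%:E)%E.
  exact: integrableZl.
rewrite integralD//=; last 2 first.
- by apply: finite_measure_integrable_cst.
- exact: integrableD.
rewrite integralD//= integralZl// integralZl// X0 mule0 add0e.
have -> : (\int[P]__ (bracket_pow p s)%:E = (bracket_pow p s)%:E)%E.
  by rewrite integral_cst// -[RHS]mule1; congr (_ * _)%E; exact: probability_setT.
rewrite mulrDr mulr1 EFinD leeD2l//.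
by rewrite EFinM lee_wpmul2l ?lee_fin.
Qed.

Lemma integral_bracket_pow_add p (c : R) (S X : {RV P >-> R}) : 2 <= p ->
  0 <= c -> independent_pair S X ->
  P.-integrable setT (EFin \o X) -> (\int[P]_w (X w)%:E = 0)%E ->
  (\int[P]_w (taylor_rem p (X w))%:E <= c%:E)%E ->
  (\int[P]_w (bracket_pow p (S w + X w))%:E <=
    (\int[P]_w (bracket_pow p (S w))%:E) * (1 + c)%:E)%E.
Proof.
move=> p2 c0 SX iX X0 Xc.
pose F (z : R * R) := (bracket_pow p (z.1 + z.2))%:E.
have mF : measurable_fun setT F.
  apply/measurable_EFinP; apply: (measurableT_comp (@measurable_bracket_pow p)).
  by apply: measurable_funD.
rewrite (@independent_integral S X F)//; last by move=> z; rewrite lee_fin powR_ge0.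
rewrite -ge0_integralZr//; last 3 first.
- apply/measurable_EFinP; apply: (measurableT_comp (@measurable_bracket_pow p)).
  exact: measurable_funP.
- by move=> w _; rewrite lee_fin powR_ge0.
- by rewrite lee_fin addr_ge0.
apply: ge0_le_integral => //.
- by move=> w _; apply: integral_ge0 => w' _; rewrite lee_fin powR_ge0.
- pose G w := (\int[distribution P X]_x F (S w, x))%E.
  have -> : (fun w => \int[P]_w' F (S w, X w'))%E = G.
    apply/funext => w; rewrite /G ge0_integral_distribution//.
      exact: measurableT_comp.
    by move=> y; rewrite lee_fin powR_ge0.
  apply: (@measurableT_comp _ _ _ _ _ _ (fubini_F (distribution P X) F)).
    by apply: measurable_fun_fubini_tonelli_F => // z; rewrite lee_fin powR_ge0.
  exact: measurable_funP.
- apply: emeasurable_funM => //; apply/measurable_EFinP.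
  apply: (measurableT_comp (@measurable_bracket_pow p)).
  exact: measurable_funP.
- by move=> w _; rewrite -EFinM; exact: integral_bracket_pow_add_cst.
Qed.

(** Each summand multiplies the integral by 1 + c i <= exp (c i), starting from V(0) = 1.
    Independence is asked between one summand and a sum of others, which is exactly what each step
    of the induction uses. *)
Lemma integral_bracket_pow_sum (I : eqType) p (s : seq I) (Z : I -> {RV P >-> R})
    (c : I -> R) : 2 <= p -> uniq s ->
  (forall i, i \in s -> 0 <= c i) ->
  (forall i (s' : seq I), i \in s -> {subset s' <= s} -> i \notin s' ->
    independent_pair (fun w => \sum_(j <- s') Z j w) (Z i)) ->
  (forall i, i \in s -> P.-integrable setT (EFin \o Z i)) ->
  (forall i, i \in s -> (\int[P]_w (Z i w)%:E = 0)%E) ->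
  (forall i, i \in s -> (\int[P]_w (taylor_rem p (Z i w))%:E <= (c i)%:E)%E) ->
  (\int[P]_w (bracket_pow p (\sum_(i <- s) Z i w))%:E <=
    (expR (\sum_(i <- s) c i))%:E)%E.
Proof.
move=> p2; elim: s => [_ _ _ _ _ _|i s IH].
  under eq_integral do rewrite big_nil /bracket_pow expr0n/= addr0 powR1.
  by rewrite integral_cst// big_nil expR0 mul1e; exact: probability_le1.
move=> /andP[is_ us] c0 ind int Z0 Zc.
have iin : i \in i :: s by rewrite mem_head.
have sub : {subset s <= i :: s} by move=> j js; rewrite inE js orbT.
have mS : measurable_fun setT (fun w => \sum_(j <- s) Z j w).
  by apply: measurable_sum => j; exact: measurable_funP.
pose mSm := isMeasurableFun.Build _ _ _ _ _ mS.
pose S : {RV P >-> R} := HB.pack (fun w => \sum_(j <- s) Z j w) mSm.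
under eq_integral do rewrite big_cons addrC.
apply: (@le_trans _ _ ((\int[P]_w (bracket_pow p (S w))%:E) * (1 + c i)%:E)%E).
  apply: (@integral_bracket_pow_add p (c i) S (Z i)) => //; [exact: c0|exact: ind|exact: int
    |exact: Z0|exact: Zc].
rewrite big_cons [c i + _]addrC expRD EFinM; apply: lee_pmul.
- by apply: integral_ge0 => w _; rewrite lee_fin powR_ge0.
- by rewrite lee_fin addr_ge0// c0.
- apply: IH => // j.
  + by move=> js; rewrite c0// sub.
  + move=> s' js s's; apply: ind; first exact: sub.
    by move=> k /s's /sub.
  + by move=> /sub; exact: int.
  + by move=> /sub; exact: Z0.
  + by move=> /sub; exact: Zc.
- by rewrite lee_fin expR_ge1Dx.
Qed.

Lemma Lnorm_le_powR (p b : R) (S : Omega -> R) : 0 < p -> 0 <= b ->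
  (\int[P]_w (`|S w| `^ p)%:E <= (b `^ p)%:E)%E ->
  ('N[P]_(p%:E)[EFin \o S] <= b%:E)%E.
Proof.
move=> p0 b0 h; rewrite unlock /=.
have -> : b%:E = ((b `^ p)%:E `^ p^-1)%E.
  by rewrite poweR_EFin -powRrM mulfV ?gt_eqF// powRr1.
apply: gt0_ler_poweR => //.
- by rewrite invr_ge0 ltW.
- rewrite in_itv/= leey andbT; apply: integral_ge0 => w _; by rewrite lee_fin powR_ge0.
- by rewrite in_itv/= leey andbT lee_fin powR_ge0.
Qed.

Lemma rosenthal (I : eqType) p (s : seq I) (Z : I -> {RV P >-> R})
    (u v : I -> R) (x y : R) : 2 <= p -> uniq s ->
  (forall i (s' : seq I), i \in s -> {subset s' <= s} -> i \notin s' ->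
    independent_pair (fun w => \sum_(j <- s') Z j w) (Z i)) ->
  (forall i, i \in s -> P.-integrable setT (EFin \o Z i)) ->
  (forall i, i \in s -> (\int[P]_w (Z i w)%:E = 0)%E) ->
  (forall i, i \in s -> (\int[P]_w ((Z i w) ^+ 2)%:E <= (u i)%:E)%E) ->
  (forall i, i \in s -> (\int[P]_w (`|Z i w| `^ p)%:E <= (v i)%:E)%E) ->
  0 <= x -> 0 <= y ->
  \sum_(i <- s) u i <= x ^+ 2 -> \sum_(i <- s) v i <= y `^ p ->
  ('N[P]_(p%:E)[(fun w => (\sum_(i <- s) Z i w)%:E)] <=
    (145 / 10 * p / ln p * (x + y))%:E)%E.
Proof.
move=> p2 us ind int Z0 Zu Zv x0 y0 ux vy.
have p0 : 0 < p by lra.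
have L0 := ln_gt0_ge2 p2.
have C0 : 0 < 10 * p / ln p by rewrite divr_gt0//; lra.
(* The extra [e] keeps the scale [t] positive when x = y = 0; it is removed by letting it tend to
   0. *)
suff key e : 0 < e -> ('N[P]_(p%:E)[(fun w => (\sum_(i <- s) Z i w)%:E)] <=
    (145 / 10 * p / ln p * (x + y + e))%:E)%E.
  apply/lee_addgt0Pr => e e0.
  have C1 : 0 < 145 / 10 * p / ln p by rewrite divr_gt0//; lra.
  have := key (e / (145 / 10 * p / ln p)) ltac:(by rewrite divr_gt0).
  by rewrite [X in (_ <= X%:E)%E -> _]mulrDr [_ * (_ / _)]mulrC divfK ?gt_eqF// EFinD.
move=> e0.
pose t := 10 * p / ln p * (x + y + e).
have t0 : 0 < t by rewrite mulr_gt0//; lra.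
have xt : 10 * p / ln p * x <= t by rewrite ler_pM2l//; lra.
have yt : 10 * p / ln p * y <= t by rewrite ler_pM2l//; lra.
pose D := ln p / (2 * p).
have D0 : 0 < D by rewrite divr_gt0//; lra.
pose al := (1 + D) `^ (p - 2).
pose be := (1 + D^-1) `^ (p - 2).
have al0 : 0 <= al by exact: powR_ge0.
have be0 : 0 <= be by exact: powR_ge0.
have pp0 : 0 <= p * (p - 1) by nra.
have u0 i : i \in s -> 0 <= u i.
  move=> /Zu h; rewrite -lee_fin (le_trans _ h)//; apply: integral_ge0 => w _.
  by rewrite lee_fin sqr_ge0.
have v0 i : i \in s -> 0 <= v i.
  move=> /Zv h; rewrite -lee_fin (le_trans _ h)//; apply: integral_ge0 => w _.
  by rewrite lee_fin powR_ge0.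
have mZt i : measurable_fun setT (fun w => t^-1 * Z i w).
  by apply: measurable_funM => //; exact: measurable_funP.
pose Ztm i := isMeasurableFun.Build _ _ _ _ _ (mZt i).
pose Zt i : {RV P >-> R} := HB.pack (fun w => t^-1 * Z i w) (Ztm i).
(* Bound on the expected Taylor remainder of Z i / t, obtained by splitting it at the threshold
   [D]. *)
pose c i := p * (p - 1) * (al * (t^-1 ^+ 2 * u i) + be * (t^-1 `^ p * v i)).
have sumc : \sum_(i <- s) c i <= p * 5^-1.
  rewrite /c -mulr_sumr big_split/= -!mulr_sumr.
  apply: le_trans (rosenthal_exponent p2 t0 x0 y0 xt yt).
  rewrite ler_wpM2l// lerD// ler_wpM2l//.
    by rewrite exprMn mulrC ler_wpM2r// sqr_ge0.
  by rewrite powRM ?invr_ge0 ?(ltW t0)// mulrC ler_wpM2r// powR_ge0.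
have main : (\int[P]_w (bracket_pow p (\sum_(i <- s) Zt i w))%:E <=
    (expR (\sum_(i <- s) c i))%:E)%E.
  apply: integral_bracket_pow_sum => //.
  - move=> i si; rewrite /c mulr_ge0// addr_ge0// !mulr_ge0 ?powR_ge0 ?invr_ge0//;
      by [exact: ltW|exact: u0|exact: v0].
  - move=> i s' si s's is' A B mA mB.
    pose tA := (fun r : R => t^-1 * r) @^-1` A.
    pose tB := (fun r : R => t^-1 * r) @^-1` B.
    have mt : measurable_fun setT (fun r : R => t^-1 * r).
      exact: measurable_funM.
    have mtA : measurable tA by rewrite -[tA]setTI; exact: mt.
    have mtB : measurable tB by rewrite -[tB]setTI; exact: mt.
    have := ind i s' si s's is' tA tB mtA mtB.
    rewrite (_ : (fun w => \sum_(j <- s') Z j w) @^-1` tA =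
      (fun w => \sum_(j <- s') Zt j w) @^-1` A)//.
    by apply/seteqP; split => w; rewrite /tA /= -mulr_sumr.
  - move=> i si /=.
    rewrite (_ : EFin \o _ = (fun w => t^-1%:E * (EFin \o Z i) w)%E)//.
    by apply: integrableZl => //; exact: int.
  - move=> i si /=; under eq_integral do rewrite EFinM.
    by rewrite integralZl ?Z0 ?mule0//; exact: int.
  - move=> i si /=.
    have mZ2 : measurable_fun setT (fun w => ((Z i w) ^+ 2)%:E).
      by apply/measurable_EFinP/measurable_funX; exact: measurable_funP.
    have mZp : measurable_fun setT (fun w => (`|Z i w| `^ p)%:E).
      apply/measurable_EFinP.
      apply: (@measurableT_comp _ _ _ _ _ _ (@powR R ^~ p)) => //.
      by apply: measurableT_comp => //; exact: measurable_funP.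
    pose A := p * (p - 1) * al * t^-1 ^+ 2.
    pose B := p * (p - 1) * be * t^-1 `^ p.
    have A0 : 0 <= A by rewrite mulr_ge0 ?sqr_ge0// mulr_ge0.
    have B0 : 0 <= B by rewrite mulr_ge0 ?powR_ge0// mulr_ge0.
    apply: (@le_trans _ _ (\int[P]_w (A%:E * ((Z i w) ^+ 2)%:E +
        B%:E * (`|Z i w| `^ p)%:E))%E).
      apply: ge0_le_integral => //.
      + by move=> w _; rewrite lee_fin taylor_rem_ge0.
      + apply/measurable_EFinP; apply: (measurableT_comp (@measurable_taylor_rem p)).
        exact: mZt.
      + by apply: emeasurable_funD; exact: emeasurable_funM.
      + move=> w _; rewrite -!EFinM -EFinD lee_fin.
        apply: (le_trans (taylor_rem_split _ p2 D0)).
        rewrite -/al -/be normrM powRM ?invr_ge0 ?normr_ge0//.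
        rewrite (@ger0_norm _ t^-1) ?invr_ge0 ?(ltW t0)// exprMn.
        by rewrite le_eqVlt; apply/orP; left; apply/eqP; rewrite /A /B; ring.
    rewrite ge0_integralD//; last 4 first.
    + by move=> w _; rewrite mule_ge0// lee_fin ?sqr_ge0.
    + exact: emeasurable_funM.
    + by move=> w _; rewrite mule_ge0// lee_fin ?powR_ge0.
    + exact: emeasurable_funM.
    rewrite ge0_integralZl//; last by move=> w _; rewrite lee_fin sqr_ge0.
    rewrite ge0_integralZl//.
    apply: (@le_trans _ _ (A%:E * (u i)%:E + B%:E * (v i)%:E)%E).
      by rewrite leeD// lee_wpmul2l ?lee_fin//; [exact: Zu|exact: Zv].
    rewrite -!EFinM -EFinD lee_fin le_eqVlt; apply/orP; left; apply/eqP.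
    by rewrite /A /B /c; ring.
have mZs : measurable_fun setT (fun w => \sum_(j <- s) Z j w).
  by apply: measurable_sum => j; exact: measurable_funP.
have te0 : 0 <= t * expR 5^-1 by rewrite mulr_ge0 ?expR_ge0// ltW.
(* The p-th moment of the sum is at most t^p exp(p/5), whose p-th root is t exp(1/5). *)
apply: (@le_trans _ _ (t * expR 5^-1)%:E); last first.
  rewrite lee_fin /t; have := @exp_fifth_le R.
  have : 0 <= p / ln p * (x + y + e) by rewrite mulr_ge0 ?divr_ge0//; lra.
  set w := _ * (x + y + e) => w0 h.
  rewrite (_ : 10 * p / ln p * _ * _ = w * (10 * expR 5^-1)); last by rewrite /w; ring.
  rewrite (_ : 145 / 10 * p / ln p * _ = w * (145 / 10)); last by rewrite /w; ring.
  by rewrite ler_wpM2l.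
apply: (@Lnorm_le_powR p (t * expR 5^-1) (fun w => \sum_(i <- s) Z i w)) => //.
apply: (@le_trans _ _ (\int[P]_w ((t `^ p)%:E * (bracket_pow p (\sum_(i <- s) Zt i w))%:E))%E).
  apply: ge0_le_integral => //.
  - apply/measurable_EFinP.
    apply: (@measurableT_comp _ _ _ _ _ _ (@powR R ^~ p)) => //.
    exact: measurableT_comp.
  - apply: emeasurable_funM => //; apply/measurable_EFinP.
    apply: (measurableT_comp (@measurable_bracket_pow p)).
    by apply: measurable_sum => j; exact: measurable_funP.
  - move=> w _; rewrite -EFinM lee_fin /bracket_pow /= -mulr_sumr.
    set r := \sum_(i <- s) _.
    have -> : `|r| `^ p = t `^ p * ((t^-1 * r) ^+ 2) `^ (p / 2).
      rewrite -(real_normK (num_real (t^-1 * r))) -powR_mulrn ?normr_ge0//.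
      rewrite -powRrM (_ : 2%:R * (p / 2) = p); last by field.
      rewrite -powRM ?(ltW t0)// normrM ger0_norm ?invr_ge0 ?(ltW t0)//.
      by rewrite mulrA mulfV ?gt_eqF// mul1r.
    rewrite ler_wpM2l ?powR_ge0//; apply: ge0_ler_powR; rewrite ?nnegrE ?sqr_ge0//;
      have := sqr_ge0 (t^-1 * r); lra.
rewrite ge0_integralZl//; last 3 first.
- apply/measurable_EFinP; apply: (measurableT_comp (@measurable_bracket_pow p)).
  by apply: measurable_sum => j; exact: measurable_funP.
- by move=> w _; rewrite lee_fin powR_ge0.
- by rewrite lee_fin powR_ge0.
apply: (@le_trans _ _ ((t `^ p)%:E * (expR (\sum_(i <- s) c i))%:E)%E).
  by rewrite lee_wpmul2l// lee_fin powR_ge0.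
rewrite -EFinM lee_fin powRM ?expR_ge0 ?(ltW t0)// -expRM ler_wpM2l ?powR_ge0//.
by rewrite ler_expR mulrC.
Qed.

End rosenthal.

(** * Path space of an i.i.d. family *)

Section independence_extension.
Context (disp : measure_display) (Omega : measurableType disp) (R : realType).
Variable P : probability Omega R.

(** Dynkin's argument with the event [H] held fixed. Freezing one event at a time lets the lemma be
    applied first to one factor and then to the other. *)
Lemma independent_of_generator (T : pointedType) (G : set (set T)) (f : Omega -> T)
    (H : set Omega) :
  setI_closed G -> (forall A, <<s G >> A -> measurable (f @^-1` A)) ->
  measurable H ->
  (forall A, G A -> P (f @^-1` A `&` H) = (P (f @^-1` A) * P H)%E) ->
  forall A, <<s G >> A -> P (f @^-1` A `&` H) = (P (f @^-1` A) * P H)%E.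
Proof.
move=> IG mf mH GH.
pose L := [set A | <<s G >> A /\ P (f @^-1` A `&` H) = (P (f @^-1` A) * P H)%E].
suff LG : <<s G >> `<=` L by move=> A /LG[].
have sG : sigma_algebra setT <<s G >> by exact: smallest_sigma_algebra.
have fP (A : set Omega) : measurable A -> P A \is a fin_num.
  by move=> mA; exact: fin_num_measure.
apply: lambda_system_subset => //; last first.
  by move=> A GA; split; [exact: sub_sigma_algebra|exact: GH].
split => //.
- split; first exact: (@measurableT _ (g_sigma_algebraType G)).
  rewrite preimage_setT setTI.
  by rewrite [X in (X * _)%E](_ : _ = 1%E) ?mul1e//; exact: probability_setT.
- move=> A B BA [sA hA] [sB hB].
  have sAB : <<s G >> (A `\` B) by exact: (@measurableD _ (g_sigma_algebraType G)).
  split => //.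
  have mA := mf _ sA; have mB := mf _ sB.
  rewrite (_ : f @^-1` (A `\` B) = f @^-1` A `\` f @^-1` B)//.
  rewrite (_ : (f @^-1` A `\` f @^-1` B) `&` H =
    (f @^-1` A `&` H) `\` (f @^-1` B `&` H)); last first.
    apply/seteqP; split => w /=; tauto.
  have BA' : f @^-1` B `<=` f @^-1` A by move=> w; exact: BA.
  have mAH : measurable (f @^-1` A `&` H) by exact: measurableI.
  have mBH : measurable (f @^-1` B `&` H) by exact: measurableI.
  have lA : (P (f @^-1` A) < +oo)%E by rewrite ltey_eq fP.
  have lAH : (P (f @^-1` A `&` H) < +oo)%E by rewrite ltey_eq fP.
  rewrite !measureD//.
  rewrite (setIidr BA') (_ : (_ `&` _) `&` _ = f @^-1` B `&` H); last first.
    by apply/seteqP; split => w /=; [tauto|move=> [Bw Hw]; have := BA' _ Bw; tauto].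
  rewrite -[LHS]/(P (f @^-1` A `&` H) - P (f @^-1` B `&` H))%E hA hB.
  rewrite -[RHS]/((P (f @^-1` A) - P (f @^-1` B)) * P H)%E.
  by rewrite muleBl ?fP// fin_num_adde_defr// fP.
- move=> F ndF LF.
  have sF n : <<s G >> (F n) by have [] := LF n.
  have mF n := mf _ (sF n).
  have FF m n : (m <= n)%N -> F m `<=` F n by move=> mn; apply/subsetPset/ndF.
  have sU : <<s G >> (\bigcup_n F n) by exact: (@bigcupT_measurable _ (g_sigma_algebraType G)).
  split => //.
  have c1 : P \o (fun n => f @^-1` F n `&` H) @ \oo -->
      P (\bigcup_n (f @^-1` F n `&` H)).
    apply: nondecreasing_cvg_mu.
    + by move=> n; exact: measurableI.
    + by apply: bigcup_measurable => n _; exact: measurableI.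
    + by move=> m n mn; apply/subsetPset => w [Fw Hw]; split => //;
        exact: (FF _ _ mn).
  have c2 : P \o (fun n => f @^-1` F n) @ \oo --> P (\bigcup_n (f @^-1` F n)).
    apply: nondecreasing_cvg_mu => //.
    + exact: bigcup_measurable.
    + by move=> m n mn; apply/subsetPset => w; exact: (FF _ _ mn).
  rewrite preimage_bigcup -setI_bigcupl in c1 *.
  have c3 : P \o (fun n => f @^-1` F n `&` H) @ \oo -->
      (P (\bigcup_n (f @^-1` F n)) * P H)%E.
    rewrite (_ : P \o _ = fun n => ((P \o (fun n => f @^-1` F n)) n * P H)%E).
      by apply: cvgeZr => //; exact: fP.
    by apply/funext => n /=; have [] := LF n.
  exact: (cvg_unique _ c1 c3).
Qed.

End independence_extension.

(** * Cylinders, and independence over disjoint sets of indices *)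

Section path_space.
Context (I : choiceType) (R : realType).
Local Notation path := (g_sigma_algebraType (@coordinate_sets I R)).

Lemma measurable_coordinate (u : I) :
  measurable_fun setT ((fun x => x u) : path -> R).
Proof.
move=> _ B mB; rewrite setTI; apply: sub_sigma_algebra.
by exists u => //; exists B => //; rewrite setTI.
Qed.

Lemma measurable_to_path (d : measure_display) (T : measurableType d)
    (g : T -> path) :
  (forall u, measurable_fun setT (fun w => g w u : R)) -> measurable_fun setT g.
Proof.
move=> mg; apply: (@measurability _ _ T path setT g (@coordinate_sets I R)) => //.
move=> _ [_ [u _ [B mB <-]] <-].
rewrite setTI (_ : _ @^-1` _ = (fun w => g w u) @^-1` B); last by rewrite setTI.
by rewrite -[X in measurable X]setTI; exact: mg.
Qed.

(** Coordinates outside [A] are set to the default 0 instead of being dropped, so that all the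
    sub-sigma-algebras are described on one and the same path space. *)
Definition restrict_path (A : set I) (x : path) : path :=
  fun u => if `[< A u >] then (x : I -> R) u else 0.

Lemma measurable_restrict_path (A : set I) :
  measurable_fun setT (restrict_path A).
Proof.
apply: measurable_to_path => u; rewrite /restrict_path.
by case: asboolP => _; [exact: measurable_coordinate|exact: measurable_cst].
Qed.

Lemma restrict_pathK (A B : set I) (x : path) : A `<=` B ->
  restrict_path A (restrict_path B x) = restrict_path A x.
Proof.
move=> AB; apply/funext => u; rewrite /restrict_path.
by case: asboolP => // Au; case: asboolP => // /(_ (AB _ Au)).
Qed.

(** These are the finite-dimensional cylinders, the pi-system generating the product sigma-algebra;
    they are unrelated to the lattice boxes [box]. *)
Definition box_set (J : {fset I}) (B : I -> set R) : set path :=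
  [set x : path | forall u, u \in J -> B u (x u)].

Definition box_sets : set (set path) :=
  [set G | exists J B, (forall u, measurable (B u)) /\ G = box_set J B].

Lemma setI_closed_box_sets : setI_closed box_sets.
Proof.
move=> _ _ [J [B [mB ->]]] [J' [B' [mB' ->]]].
exists (J `|` J')%fset.
exists (fun u => (if u \in J then B u else setT) `&` (if u \in J' then B' u else setT)).
split; first by move=> u; apply: measurableI; case: ifP.
apply/seteqP; split => [x [h h'] u _|x h] /=.
  by split; case: ifP => // ?; [exact: h|exact: h'].
split => u uJ /=.
  by have := h u; rewrite inE uJ/= => /(_ isT)[].
by have := h u; rewrite inE uJ orbT/= => /(_ isT)[].
Qed.

Lemma measurable_box_set (J : {fset I}) (B : I -> set R) :
  (forall u, measurable (B u)) -> measurable (box_set J B : set path).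
Proof.
move=> mB.
rewrite (_ : box_set J B = \bigcap_(u in [set` J]) ((fun x : path => x u) @^-1` B u)).
  apply: fin_bigcap_measurable => // u _.
  by rewrite -[X in measurable X]setTI; exact: measurable_coordinate.
by apply/seteqP; split => x h u; exact: h.
Qed.

Lemma box_sets_generate : (measurable : set (set path)) = <<s box_sets >>.
Proof.
apply/seteqP; split.
  apply: smallest_sub; first exact: smallest_sigma_algebra.
  move=> _ [u _ [B mB <-]]; apply: sub_sigma_algebra.
  exists [fset u]%fset, (fun=> B); split => //.
  apply/seteqP; split => [x [_ Bx] v|x h]; first by rewrite inE => /eqP ->.
  by split => //=; apply: h; rewrite inE.
apply: smallest_sub; first exact: sigma_algebra_measurable.
by move=> _ [J [B [mB ->]]]; exact: measurable_box_set.
Qed.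

Section random_path.
Context (disp : measure_display) (Omega : measurableType disp).
Variable P : probability Omega R.
Variable eps : I -> {RV P >-> R}.

Definition random_path (w : Omega) : path := fun u => eps u w.

Lemma measurable_random_path : measurable_fun setT random_path.
Proof. by apply: measurable_to_path => u; exact: measurable_funP. Qed.

Hypothesis ind : mutually_independent eps.

Lemma probability_box_set (J : {fset I}) (B : I -> set R) :
  (forall u, measurable (B u)) ->
  P (random_path @^-1` box_set J B) = (\prod_(u <- J) P (eps u @^-1` B u))%E.
Proof.
by move=> mB; rewrite -ind//; congr (P _).
Qed.

(* At each coordinate u one of the two families of constraints is trivial (setT
   or set0, as u lies outside A or outside A'), hence the product rule holds
   coordinatewise. *)
Lemma independent_restrict_box_set (A A' : set I) (J J' : {fset I})
    (B B' : I -> set R) : A `&` A' = set0 ->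
  (forall u, measurable (B u)) -> (forall u, measurable (B' u)) ->
  let rA := restrict_path A \o random_path in
  let rA' := restrict_path A' \o random_path in
  P (rA @^-1` box_set J B `&` rA' @^-1` box_set J' B') =
  (P (rA @^-1` box_set J B) * P (rA' @^-1` box_set J' B'))%E.
Proof.
move=> AA' mB mB' rA rA'.
(* Constraints on the restricted path are rewritten on the full path: outside [A] the coordinate is
   the constant 0, so its constraint is either vacuous or impossible. *)
pose C (A : set I) (J : {fset I}) (B : I -> set R) u :=
  if u \in J then if `[< A u >] then B u else if `[< B u 0 >] then setT else set0
  else setT.
pose K := (J `|` J')%fset.
have mC A1 J1 B1 u : (forall u, measurable (B1 u)) -> measurable (C A1 J1 B1 u).
  by rewrite /C => ?; case: ifP => // _; case: asboolP => // _; case: asboolP.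
have CE (A1 : set I) (J1 : {fset I}) (B1 : I -> set R) : {subset J1 <= K} ->
    (restrict_path A1 \o random_path) @^-1` box_set J1 B1 =
    random_path @^-1` box_set K (C A1 J1 B1).
  move=> J1K; apply/seteqP; split => w h u uJ /=.
  - rewrite /C; case: ifPn => // uJ1; have := h u uJ1.
    rewrite /= /restrict_path; case: asboolP => // _.
    by case: asboolP.
  - have := h u (J1K _ uJ); rewrite /C uJ /= /restrict_path.
    by case: asboolP => // _; case: asboolP.
rewrite /rA /rA' !CE; last 2 first.
- by move=> u; rewrite inE => ->; rewrite orbT.
- by move=> u; rewrite inE => ->.
rewrite (_ : _ `&` _ = random_path @^-1` box_set K
    (fun u => C A J B u `&` C A' J' B' u)); last first.
  apply/seteqP; split => [w [h h'] u uK|w h].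
    by split; [exact: h|exact: h'].
  by split => u uK; have [] := h u uK.
rewrite !probability_box_set; [|by move=> u; exact: mC|by move=> u; exact: mC|
  by move=> u; apply: measurableI; exact: mC].
rewrite -big_split/=; apply: eq_bigr => u _.
have triv (A1 : set I) J1 B1 : ~ A1 u -> C A1 J1 B1 u = setT \/ C A1 J1 B1 u = set0.
  rewrite /C; case: ifP => _; last by left.
  by case: asboolP => // _ _; case: asboolP => _; [left|right].
have trivP (E : set R) F : E = setT \/ E = set0 ->
    P (eps u @^-1` (E `&` F)) = (P (eps u @^-1` E) * P (eps u @^-1` F))%E.
  move=> [] ->.
    rewrite setTI preimage_setT [X in (X * _)%E](_ : _ = 1%E) ?mul1e//.
    exact: probability_setT.
  by rewrite set0I preimage_set0 measure0 mul0e.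
have [Au|nAu] := pselect (A u).
  have nA'u : ~ A' u.
    by move=> A'u; have : (A `&` A') u by []; rewrite AA'.
  by rewrite setIC muleC; apply: trivP; exact: triv.
by apply: trivP; exact: triv.
Qed.

(** Two nested extensions from cylinders: the outer one lets [G] vary with [G'] fixed, the inner one
    lets [G'] vary with [G] already a cylinder. *)
Lemma independent_restrict (A A' : set I) (G G' : set path) :
  A `&` A' = set0 -> measurable G -> measurable G' ->
  let rA := restrict_path A \o random_path in
  let rA' := restrict_path A' \o random_path in
  P (rA @^-1` G `&` rA' @^-1` G') = (P (rA @^-1` G) * P (rA' @^-1` G'))%E.
Proof.
move=> AA' mG mG' rA rA'.
have mr (A1 : set I) (H : set path) : <<s box_sets >> H ->
    measurable ((restrict_path A1 \o random_path) @^-1` H).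
  rewrite -box_sets_generate => mH; rewrite -[X in measurable X]setTI.
  apply: measurableT_comp => //.
    exact: measurable_restrict_path.
  exact: measurable_random_path.
have [sG sG'] : <<s box_sets >> G /\ <<s box_sets >> G'.
  by rewrite -!box_sets_generate.
apply: (independent_of_generator setI_closed_box_sets) sG => //.
- exact: mr.
- exact: mr.
- move=> B [J [C [mC ->]]]; rewrite setIC muleC.
  apply: (independent_of_generator setI_closed_box_sets) sG' => //.
  + exact: mr.
  + by apply: mr; apply: sub_sigma_algebra; exists J, C.
  + move=> B' [J' [C' [mC' ->]]].
    by rewrite setIC muleC; exact: independent_restrict_box_set.
Qed.

(** For a measurable [g], this stands for measurability with respect to the coordinates in [A],
    stated as an identity that composes with shifts and sums. *)
Definition depends_on (A : set I) (g : path -> R) :=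
  forall x, g (restrict_path A x) = g x.

Lemma independent_depends_on (A A' : set I) (g g' : path -> R) :
  A `&` A' = set0 -> measurable_fun setT g -> measurable_fun setT g' ->
  depends_on A g -> depends_on A' g' ->
  independent_pair P (g \o random_path) (g' \o random_path).
Proof.
move=> AA' mg mg' gA gA' B B' mB mB'.
have mgB : measurable (g @^-1` B) by rewrite -[X in measurable X]setTI; exact: mg.
have mgB' : measurable (g' @^-1` B') by rewrite -[X in measurable X]setTI; exact: mg'.
have := independent_restrict AA' mgB mgB'.
rewrite /= (_ : (restrict_path A \o random_path) @^-1` _ = (g \o random_path) @^-1` B).
  rewrite (_ : (restrict_path A' \o random_path) @^-1` _ = (g' \o random_path) @^-1` B')//.
  by apply/seteqP; split => w; rewrite /= gA'.
by apply/seteqP; split => w; rewrite /= gA.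
Qed.

End random_path.
End path_space.

(** * Invariance of the law under translations of the index set *)

Section shift_path.
Context (I : zmodType) (R : realType).
Local Notation path := (g_sigma_algebraType (@coordinate_sets I R)).

Definition shift_path (j : I) (x : path) : path := fun u => (x : I -> R) (j + u).

Lemma measurable_shift_path j : measurable_fun setT (shift_path j).
Proof. by apply: measurable_to_path => u; exact: measurable_coordinate. Qed.

Context (disp : measure_display) (Omega : measurableType disp).
Variable P : probability Omega R.
Variable eps : I -> {RV P >-> R}.
Hypothesis eps_iid : iid eps.

(** A translated cylinder is a cylinder over translated indices, and its probability is a product of
    marginal probabilities, which are all governed by one law. Agreement on cylinders determines the
    measure. *)
Lemma probability_shift_path j (G : set path) : measurable G ->
  P ((shift_path j \o random_path eps) @^-1` G) = P (random_path eps @^-1` G).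
Proof.
move=> mG.
have [ind idd] := eps_iid.
pose m1 := isMeasurableFun.Build _ _ _ _ _ (measurable_random_path eps).
pose X1 : {mfun Omega >-> path} := HB.pack (random_path eps) m1.
have ms : measurable_fun setT (shift_path j \o random_path eps).
  apply: measurableT_comp; first exact: measurable_shift_path.
  exact: measurable_random_path.
pose m2 := isMeasurableFun.Build _ _ _ _ _ ms.
pose X2 : {mfun Omega >-> path} := HB.pack (shift_path j \o random_path eps) m2.
have := @measure_unique _ _ path (@box_sets I R) (fun=> setT) (@box_sets_generate I R)
  (@setI_closed_box_sets I R) _ _ (distribution P X2) (distribution P X1) _ _ G mG.
apply.
- move=> _; exists fset0, (fun=> setT); split => //.
  by apply/seteqP; split.
- by apply/seteqP; split => // x _; exists 0%N.
- move=> _ [J [B [mB ->]]]; rewrite /distribution /pushforward.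
  rewrite [RHS](probability_box_set ind)//.
  pose J' := [fset (j + u)%R | u in J]%fset.
  pose B' u := B (u - j).
  transitivity (P (random_path eps @^-1` box_set J' B')); last first.
    rewrite (probability_box_set ind); last by move=> u; exact: mB.
    rewrite /J' big_imfset/=; last by move=> u v _ _; exact: addrI.
    by apply: eq_bigr => u _; rewrite /B' [j + u]addrC addrK; exact: idd.
  congr (P _); apply/seteqP; split => w h u.
    by move=> /imfsetP[v vJ ->]; rewrite /B' [j + v]addrC addrK addrC; exact: (h v vJ).
  move=> uJ; have := h (j + u); rewrite /B' [j + u - j]addrAC subrr add0r; apply.
  by apply/imfsetP; exists u.
- by move=> _; rewrite /distribution/= (le_lt_trans (probability_le1 _ _))// ltry.
Qed.

Lemma ge0_integral_shift_path j (F : path -> \bar R) : measurable_fun setT F ->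
  (forall x, (0 <= F x)%E) ->
  (\int[P]_w F (shift_path j (random_path eps w)) =
   \int[P]_w F (random_path eps w))%E.
Proof.
move=> mF F0.
pose m1 := isMeasurableFun.Build _ _ _ _ _ (measurable_random_path eps).
pose X1 : {mfun Omega >-> path} := HB.pack (random_path eps) m1.
have ms : measurable_fun setT (shift_path j \o random_path eps).
  apply: measurableT_comp; first exact: measurable_shift_path.
  exact: measurable_random_path.
pose m2 := isMeasurableFun.Build _ _ _ _ _ ms.
pose X2 : {mfun Omega >-> path} := HB.pack (shift_path j \o random_path eps) m2.
rewrite -(@ge0_integral_distribution _ _ _ _ _ P X1 F)//.
rewrite -(@ge0_integral_distribution _ _ _ _ _ P X2 F)//.
by apply: eq_measure_integral => A mA _; exact: probability_shift_path.
Qed.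

End shift_path.

(** * L1 convergence of conditional expectations *)

Lemma cvg_EFin_near (R : realType) (u : nat -> \bar R) (l : R) :
  u @ \oo --> l%:E -> forall e : R, 0 < e -> exists N, forall n, (N <= n)%N ->
    u n \is a fin_num /\ `|l - fine (u n)| < e.
Proof.
move=> /fine_cvgP[[N _ hN]] /cvgrPdist_lt cu e e0.
have [M _ hM] := cu e e0.
exists (maxn N M) => n; rewrite geq_max => /andP[Nn Mn].
by split; [exact: hN|exact: hM].
Qed.

Lemma cvg_EFin0_near (R : realType) (u : nat -> \bar R) :
  u @ \oo --> (0 : \bar R)%E -> forall e : R, 0 < e -> exists N, forall n, (N <= n)%N ->
    (u n <= e%:E)%E.
Proof.
move=> /cvg_EFin_near cu e e0; have [N hN] := cu e e0.
exists N => n /hN[fn]; rewrite sub0r normrN => h.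
by rewrite -(fineK fn) lee_fin ltW// (le_lt_trans (ler_norm _)).
Qed.

(** Y is the infimum of the rationals above it, and each event Y < q comes from a set [G q]; so
    [phi] is the infimum of the rationals q with x in [G q]. *)
Lemma doob_dynkin (R : realType) (Omega : Type) (d : measure_display)
    (T : measurableType d) (h : Omega -> T) (Y : Omega -> R) :
  (forall q : R, exists2 G, measurable G & Y @^-1` `]-oo, q[ = h @^-1` G) ->
  exists2 phi : T -> R, measurable_fun setT phi & forall w, Y w = phi (h w).
Proof.
move=> hY.
have /choice[G hG] : forall q : rat, exists G : set T,
    measurable G /\ Y @^-1` `]-oo, ratr q[ = h @^-1` G.
  by move=> q; have [G mG GE] := hY (ratr q); exists G.
(* Rationals are enumerated by decoding natural numbers, which makes [phi] a countable infimum;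
   indices that decode to nothing get +oo and do not affect it. *)
pose u (n : nat) (x : T) : \bar R :=
  if (choice.unpickle n : option rat) is Some q
  then (if `[< G q x >] then (ratr q)%:E else +oo)%E else +oo%E.
pose phi x := ereal_inf (range (fun n => u n x)).
exists (fine \o phi).
  apply: (measurableT_comp (@fine_measurable R setT measurableT)).
  have -> : phi = fun x => einfs (u ^~ x) 0.
    apply/funext => x; rewrite /phi /einfs /sdrop; congr ereal_inf.
    by apply/seteqP; split => [_ [n _ <-]|_ [n _ <-]]; exists n.
  apply: measurable_fun_einfs => n.
  rewrite /u; case: (choice.unpickle n : option rat) => [q|]; last exact: measurable_cst.
  apply: measurable_fun_ifT => //.
  apply: (measurable_fun_bool true).
  rewrite setTI (_ : _ @^-1` _ = G q); first exact: (hG q).1.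
  by apply/seteqP; split => x /= => [/asboolP|?]; [|apply/asboolP].
move=> w /=; suff -> : phi (h w) = (Y w)%:E by [].
apply/eqP; rewrite eq_le; apply/andP; split.
- apply/lee_addgt0Pr => e e0.
  have /rat_in_itvoo[q] : Y w < Y w + e by rewrite ltrDl.
  rewrite in_itv/= => /andP[Yq qY].
  apply: (@le_trans _ _ (ratr q)%:E); last by rewrite -EFinD lee_fin ltW.
  apply: ereal_inf_lbound; exists (choice.pickle q) => //.
  rewrite /u choice.pickleK; case: asboolP => // nG; exfalso; apply: nG.
  have : (h @^-1` G q) w by rewrite -(hG q).2 /= in_itv/=.
  by [].
- apply: le_ereal_inf_tmp => _ [n _ <-].
  rewrite /u; case: (choice.unpickle n : option rat) => [q|]; last by rewrite leey.
  case: asboolP => [Gq|]; last by rewrite leey.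
  have : (h @^-1` G q) w by [].
  by rewrite -(hG q).2 /= in_itv/= lee_fin => /ltW.
Qed.

Import HBSimple.

(** * Approximation along an increasing sequence of index sets *)

Section L1_martingale.
Context (I : choiceType) (R : realType).
Local Notation path := (g_sigma_algebraType (@coordinate_sets I R)).
Context (disp : measure_display) (Omega : measurableType disp).
Variable P : probability Omega R.
Variable eps : I -> {RV P >-> R}.
Local Notation E := (random_path eps).

Lemma sigma_of_preimage (A : set I) (B : set Omega) : sigma_of eps A B ->
  exists2 G : set path, measurable G & B = (restrict_path A \o E) @^-1` G.
Proof.
pose r : Omega -> path := restrict_path A \o E.
suff h : sigma_of eps A `<=` preimage_set_system setT r (measurable : set (set path)).
  by move=> /h[G mG <-]; exists G => //; rewrite setTI.
apply: smallest_sub.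
  apply: sigma_algebra_preimage; exact: sigma_algebra_measurable.
move=> _ [u Au [C mC <-]].
exists ((fun x : path => x u) @^-1` C).
  by rewrite -[X in measurable X]setTI; exact: measurable_coordinate.
by rewrite !setTI; apply/seteqP; split => w;
  rewrite /r /= /restrict_path (asboolT Au).
Qed.

Lemma sigma_of_restrict (A : set I) (G : set path) : measurable G ->
  sigma_of eps A ((restrict_path A \o E) @^-1` G).
Proof.
pose r : Omega -> path := restrict_path A \o E.
have sA : sigma_algebra setT (sigma_of eps A) by exact: smallest_sigma_algebra.
suff h : measurable `<=` image_set_system setT r (sigma_of eps A).
  by move=> /h; rewrite /image_set_system/= setTI.
apply: smallest_sub; first exact: sigma_algebra_image.
move=> _ [u _ [C mC <-]]; rewrite /image_set_system/= !setTI.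
(* Outside [A] the coordinate of the restricted path is identically 0, so the preimage is the whole
   space or empty. *)
have [Au|nAu] := pselect (A u).
  apply: sub_sigma_algebra; exists u => //; exists C => //.
  rewrite setTI; apply/seteqP; split => w;
    by rewrite /r /= /restrict_path (asboolT Au).
have [C0|nC0] := pselect (C 0).
  rewrite (_ : _ @^-1` _ = setT `\` set0).
    by case: sA => s0 sC _; exact: sC.
  rewrite setD0; apply/seteqP; split => // w _.
  by rewrite /r /= /restrict_path (asboolF nAu).
rewrite (_ : _ @^-1` _ = set0); first by case: sA.
apply/seteqP; split => // w.
by rewrite /r /= /restrict_path (asboolF nAu).
Qed.

Lemma sigma_of_factor (A : set I) (Y : Omega -> R) :
  (forall B : set R, measurable B -> sigma_of eps A (Y @^-1` B)) ->
  exists2 phi : path -> R, measurable_fun setT phi /\ depends_on A phi &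
    forall w, Y w = phi (E w).
Proof.
move=> hY.
have [|phi mphi phiE] := @doob_dynkin R Omega _ path (restrict_path A \o E) Y.
  by move=> q; apply: sigma_of_preimage; apply: hY; exact: measurable_itv.
exists (phi \o restrict_path A) => //; split.
  by apply: measurableT_comp => //; exact: measurable_restrict_path.
by move=> x; rewrite /= restrict_pathK.
Qed.

Lemma measurable_sigma_of (A : set I) (B : set Omega) : sigma_of eps A B ->
  measurable B.
Proof.
move=> /sigma_of_preimage[G mG ->]; rewrite -[X in measurable X]setTI.
apply: measurableT_comp => //; first exact: measurable_restrict_path.
exact: measurable_random_path.
Qed.

Variable A : nat -> set I.
Hypothesis ndA : forall m n, (m <= n)%N -> A m `<=` A n.
Hypothesis covA : forall u, exists n, A n u.

Definition L1_dist (f g : Omega -> R) : \bar R := (\int[P]_w (`|f w - g w|)%:E)%E.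

Lemma L1_dist_triangle f g h : measurable_fun setT f -> measurable_fun setT g ->
  measurable_fun setT h -> (L1_dist f h <= L1_dist f g + L1_dist g h)%E.
Proof.
move=> mf mg mh; rewrite /L1_dist -ge0_integralD//; last 2 first.
- by apply/measurable_EFinP/measurableT_comp => //; exact: measurable_funB.
- by apply/measurable_EFinP/measurableT_comp => //; exact: measurable_funB.
apply: ge0_le_integral => //.
- by apply/measurable_EFinP/measurableT_comp => //; exact: measurable_funB.
- by apply: emeasurable_funD;
    apply/measurable_EFinP/measurableT_comp => //; exact: measurable_funB.
- by move=> w _; rewrite -EFinD lee_fin ler_distD.
Qed.

Lemma L1_distC f g : L1_dist f g = L1_dist g f.
Proof. by apply: eq_integral => w _; rewrite distrC. Qed.

(** Membership in the L1 closure of the functions of one of the levels [A n]. Integrability of [g]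
    is recorded because the contraction argument subtracts integrals of [g]. *)
Definition approximable (h : path -> R) :=
  measurable_fun setT h /\ forall e : R, 0 < e ->
    exists n (g : path -> R), [/\ measurable_fun setT g, depends_on (A n) g,
      P.-integrable setT (EFin \o (g \o E)) & (L1_dist (h \o E) (g \o E) <= e%:E)%E].

Lemma measurable_comp_random_path (h : path -> R) :
  measurable_fun setT h -> measurable_fun setT (h \o E).
Proof. by move=> mh; apply: measurableT_comp => //; exact: measurable_random_path. Qed.

Lemma depends_on_le m n (g : path -> R) : (m <= n)%N -> depends_on (A m) g ->
  depends_on (A n) g.
Proof.
by move=> mn gm x; rewrite -gm restrict_pathK ?gm//; exact: ndA.
Qed.

Lemma approximable_lin (a : R) (h1 h2 : path -> R) : approximable h1 ->
  approximable h2 -> approximable (fun x => a * h1 x + h2 x).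
Proof.
move=> [mh1 ap1] [mh2 ap2]; split.
  by apply: measurable_funD => //; exact: measurable_funM.
move=> e e0.
(* The added 1 allows division when [a] is 0. *)
have a1 : 0 < `|a| + 1 by rewrite ltr_wpDl.
have [n1 [g1 [mg1 dg1 ig1 hg1]]] := ap1 (e / 2 / (`|a| + 1)) ltac:(by rewrite !divr_gt0).
have [n2 [g2 [mg2 dg2 ig2 hg2]]] := ap2 (e / 2) ltac:(by rewrite divr_gt0).
exists (maxn n1 n2), (fun x => a * g1 x + g2 x); split.
- by apply: measurable_funD => //; exact: measurable_funM.
- move=> x; rewrite (depends_on_le (leq_maxl n1 n2) dg1).
  by rewrite (depends_on_le (leq_maxr n1 n2) dg2).
- rewrite (_ : EFin \o _ = (fun w => a%:E * (EFin \o (g1 \o E)) w + (EFin \o (g2 \o E)) w)%E)//.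
  by apply: integrableD => //; exact: integrableZl.
have m1 : measurable_fun setT (fun w => (`|(h1 \o E) w - (g1 \o E) w|)%:E).
  by apply/measurable_EFinP/measurableT_comp => //;
    apply: measurable_funB; exact: measurable_comp_random_path.
have m2 : measurable_fun setT (fun w => (`|(h2 \o E) w - (g2 \o E) w|)%:E).
  by apply/measurable_EFinP/measurableT_comp => //;
    apply: measurable_funB; exact: measurable_comp_random_path.
apply: (@le_trans _ _ (`|a|%:E * L1_dist (h1 \o E) (g1 \o E) +
    L1_dist (h2 \o E) (g2 \o E))%E).
  rewrite /L1_dist -ge0_integralZl// -ge0_integralD//; last first.
    exact: emeasurable_funM.
  apply: ge0_le_integral => //.
  - apply/measurable_EFinP/measurableT_comp => //; apply: measurable_funB;
      apply: measurable_comp_random_path;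
      by apply: measurable_funD => //; exact: measurable_funM.
  - by apply: emeasurable_funD => //; exact: emeasurable_funM.
  - move=> w _; rewrite -EFinM -EFinD lee_fin -normrM /=.
    apply: le_trans (ler_normD _ _); rewrite le_eqVlt; apply/orP; left; apply/eqP.
    by congr (`|_|); ring.
apply: (@le_trans _ _ (`|a|%:E * (e / 2 / (`|a| + 1))%:E + (e / 2)%:E)%E).
  by rewrite leeD// lee_wpmul2l// lee_fin.
rewrite -EFinM -EFinD lee_fin [leRHS]splitr lerD2r mulrCA ler_piMr//.
  by rewrite divr_ge0// ltW.
by rewrite ler_pdivrMr// mul1r lerDl.
Qed.

Lemma approximable_closure (h : path -> R) : measurable_fun setT h ->
  (forall e : R, 0 < e -> exists2 g, approximable g &
    (L1_dist (h \o E) (g \o E) <= e%:E)%E) -> approximable h.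
Proof.
move=> mh ap; split => // e e0.
have e20 : 0 < e / 2 by rewrite divr_gt0.
have [g [mg apg] hg] := ap _ e20.
have [n [g' [mg' dg' ig' hg']]] := apg _ e20.
exists n, g'; split => //.
apply: le_trans (@L1_dist_triangle _ (g \o E) _ _ _ _) _;
  try exact: measurable_comp_random_path.
by rewrite [e in leRHS]splitr EFinD leeD.
Qed.

(** Pi-lambda argument. A cylinder involves finitely many coordinates, all contained in some [A n];
    proper differences are handled by linearity, and increasing unions by continuity of the
    probability from below. *)
Lemma approximable_indic (G : set path) : measurable G -> approximable \1_G.
Proof.
move=> mG.
pose L := [set G : set path | measurable G /\ approximable \1_G].
suff LG : <<s @box_sets I R >> `<=` L.
  by have /LG[] : <<s @box_sets I R >> G by rewrite -box_sets_generate.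
have mEG (B : set path) : measurable B -> measurable (E @^-1` B).
  by move=> mB; rewrite -[X in measurable X]setTI; exact: measurable_random_path.
have box1 J B : (forall u, measurable (B u)) -> approximable \1_(@box_set I R J B).
  move=> mB; have mbox := measurable_box_set J mB.
  split; first exact: measurable_indic.
  move=> e e0.
  have [n Jn] : exists n, forall u, u \in J -> A n u.
    have /choice[f hf] := covA.
    exists (\max_(u <- J) f u)%N => u uJ.
    by apply: ndA (hf u); exact: leq_bigmax_seq.
  exists n, \1_(box_set J B); split.
  - exact: measurable_indic.
  - move=> x; rewrite !indicE; congr (_%:R); congr (nat_of_bool _).
    apply/idP/idP; rewrite !inE => h u uJ; have := h u uJ;
      by rewrite /restrict_path (asboolT (Jn u uJ)).
  - rewrite (_ : EFin \o _ = EFin \o \1_(E @^-1` box_set J B))//.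
    by apply: integrable_indic => //; exact: mEG.
  - rewrite /L1_dist; under eq_integral do rewrite subrr normr0.
    by rewrite integral0 lee_fin ltW.
apply: lambda_system_subset => //; first exact: setI_closed_box_sets.
- split => //.
  + split; first exact: measurableT.
    rewrite (_ : setT = box_set fset0 (fun=> setT)); first exact: box1.
    by apply/seteqP; split => // x _ u; rewrite inE.
  + move=> B C CB [mB aB] [mC aC]; split; first exact: measurableD.
    have := approximable_lin (-1) aC aB.
    rewrite (_ : (fun x => _) = \1_(B `\` C))//.
    apply/funext => x; rewrite !indicE !in_setD.
    case: (boolP (x \in B)) => xB; case: (boolP (x \in C)) => xC /=; try ring.
    by move: xB; rewrite notin_setE => xB; exfalso; apply/xB/CB; rewrite -inE.
  + move=> F ndF LF.
    have mF n : measurable (F n : set path) by have [] := LF n.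
    have mU : measurable (\bigcup_n F n : set path) by exact: bigcupT_measurable.
    split => //; apply: approximable_closure; first exact: measurable_indic.
    move=> e e0.
    have FF m n : (m <= n)%N -> F m `<=` F n by move=> mn; apply/subsetPset/ndF.
    have c : P \o (fun n => E @^-1` F n) @ \oo --> P (\bigcup_n (E @^-1` F n)).
      apply: nondecreasing_cvg_mu.
      * by move=> n; exact: mEG.
      * by apply: bigcup_measurable => n _; exact: mEG.
      * by move=> m n mn; apply/subsetPset => w; exact: (FF _ _ mn).
    have fU : P (\bigcup_n (E @^-1` F n)) \is a fin_num.
      by apply: fin_num_measure; apply: bigcup_measurable => n _; exact: mEG.
    have cl : P \o (fun n => E @^-1` F n) @ \oo -->
        (fine (P (\bigcup_n (E @^-1` F n))))%:E by rewrite fineK.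
    have [N hN] := cvg_EFin_near cl e0.
    have [fN dN] := hN N (leqnn _).
    exists (\1_(F N)); first by have [] := LF N.
    have FU : F N `<=` \bigcup_n F n by exact: bigcup_sup.
    rewrite /L1_dist.
    have mFU : measurable (\bigcup_n F n `\` F N : set path) by exact: measurableD.
    rewrite (_ : (\int[P]_w _)%E =
      (\int[P]_w (\1_(E @^-1` (\bigcup_n F n `\` F N)) w)%:E)%E); last first.
      apply: eq_integral => w _; congr EFin; rewrite /= !indicE.
      rewrite (_ : (w \in E @^-1` (\bigcup_n F n `\` F N)) =
        (E w \in \bigcup_n F n) && ~~ (E w \in F N)); last first.
        by apply/idP/andP; rewrite !inE ?notin_setE//= => -[].
      case: (boolP (E w \in F N)) => wN /=.
        have -> : E w \in \bigcup_n F n by move: wN; rewrite !inE => /FU.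
        by rewrite subrr normr0.
      by rewrite subr0 andbT normr_nat.
    rewrite integral_indic//; last exact: mEG.
    rewrite setIT.
    have mPF n := mEG _ (mF n).
    have mPU := mEG _ mU.
    rewrite (_ : E @^-1` _ = E @^-1` (\bigcup_n F n) `\` E @^-1` F N)//.
    rewrite measureD//; last by rewrite (le_lt_trans (probability_le1 _ _))// ltry.
    rewrite (setIidr (preimage_subset FU)).
    move: fU fN dN; rewrite -preimage_bigcup /= => fU fN dN.
    rewrite -[X in (X <= _)%E]/(P (E @^-1` (\bigcup_n F n)) - P (E @^-1` F N))%E.
    rewrite -(fineK fU) -(fineK fN) -EFinB lee_fin.
    by apply/ltW; apply: le_lt_trans dN; exact: ler_norm.
- by move=> _ [J [B [mB ->]]]; split; [exact: measurable_box_set|exact: box1].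
Qed.

(** Integrable functions are L1 limits, under the law of the path, of simple functions, and these
    are linear combinations of indicators. *)
Lemma approximable_integrable (h : path -> R) : measurable_fun setT h ->
  P.-integrable setT (EFin \o (h \o E)) -> approximable h.
Proof.
move=> mh ih; apply: approximable_closure => // e e0.
pose m1 := isMeasurableFun.Build _ _ _ _ _ (measurable_random_path eps).
pose X : {mfun Omega >-> path} := HB.pack (random_path eps) m1.
have ihX : (distribution P X).-integrable setT (EFin \o h).
  apply/integrableP; split; first exact/measurable_EFinP.
  rewrite ge0_integral_distribution//; last first.
    by apply: measurableT_comp => //; exact/measurable_EFinP.
  by case/integrableP : ih.
have [g [ig _ cg]] := approximation_sfun_integrable measurableT ihX.
have [N hN] := cvg_EFin0_near cg e0.
exists (g N); last first.
  have := hN N (leqnn _); rewrite ge0_integral_distribution//.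
  apply/measurable_EFinP/measurableT_comp => //; apply: measurable_funB => //.
have -> : g N = (fun x => \sum_(i <- fset_set (range (g N)))
    i * \1_(g N @^-1` [set i]) x) :> (path -> R).
  by apply/funext => x; rewrite {1}fimfunE fsbig_finite.
elim: (enum_fset _) => [|r s IH].
  rewrite (_ : (fun x => _) = \1_set0); first exact: approximable_indic.
  by apply/funext => x; rewrite big_nil indic0.
rewrite (_ : (fun x => _) = (fun x => r * \1_(g N @^-1` [set r]) x +
   \sum_(i <- s) i * \1_(g N @^-1` [set i]) x)); last first.
  by apply/funext => x; rewrite big_cons.
apply: approximable_lin => //; apply: approximable_indic.
exact: measurable_sfunP.
Qed.

(* The set-wise definition of conditional expectation suffices: for g measurable
   with respect to the n-th sigma-algebra, E|Y_m - g| <= E|h - g| by integrating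
   the signed differences over {Y_m < g} and its complement. *)
Lemma L1_martingale_convergence (h : path -> R) (Y : nat -> Omega -> R) :
  measurable_fun setT h -> P.-integrable setT (EFin \o (h \o E)) ->
  (forall n, is_cond_exp P (sigma_of eps (A n)) (h \o E) (Y n)) ->
  forall e : R, 0 < e -> exists n, forall m, (n <= m)%N ->
    (L1_dist (Y m) (h \o E) <= e%:E)%E.
Proof.
move=> mh ih hY e e0.
have e20 : 0 < e / 2 by rewrite divr_gt0.
have [_ /(_ _ e20)[n [g [mg dg ig hg]]]] := approximable_integrable mh ih.
exists n => m nm.
have [mY iY YE] := hY m.
have dgm := depends_on_le nm dg.
have [phi [mphi dphi] phiE] := sigma_of_factor mY.
have mYm : measurable_fun setT (Y m).
  by rewrite (_ : Y m = phi \o E); [exact: measurable_comp_random_path|exact/funext].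
have mgE := measurable_comp_random_path mg.
have mhE := measurable_comp_random_path mh.
suff : (L1_dist (Y m) (g \o E) <= L1_dist (h \o E) (g \o E))%E.
  move=> le1; apply: le_trans (@L1_dist_triangle _ (g \o E) _ _ _ _) _ => //.
  rewrite [e in leRHS]splitr EFinD leeD//; first exact: le_trans hg.
  by rewrite L1_distC.
pose D := [set w | Y m w < g (E w)].
have sD : sigma_of eps (A m) D.
  rewrite (_ : D = (restrict_path (A m) \o E) @^-1` [set x | phi x < g x]).
    apply: sigma_of_restrict; rewrite -[X in measurable X]setTI.
    by apply: measurable_fun_ltr.
  by apply/seteqP; split => w; rewrite /D /= phiE dphi dgm.
have sDC : sigma_of eps (A m) (~` D).
  have sA : sigma_algebra setT (sigma_of eps (A m)) by exact: smallest_sigma_algebra.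
  by rewrite -setTD; case: sA => _ + _; apply.
have mD := measurable_sigma_of sD.
have mDC := measurable_sigma_of sDC.
have split_int f : measurable_fun setT f -> (L1_dist f (g \o E) =
    \int[P]_(w in D) (`|f w - g (E w)|)%:E +
    \int[P]_(w in ~` D) (`|f w - g (E w)|)%:E)%E.
  move=> mf; rewrite -ge0_integral_setU//; first by rewrite setUv.
  - rewrite setUv; apply/measurable_EFinP/measurableT_comp => //.
    exact: measurable_funB.
  - by apply/disj_setPCl.
have key f (B : set Omega) (s : R) : sigma_of eps (A m) B ->
    P.-integrable setT (EFin \o f) ->
    (\int[P]_(w in B) (s * (f w - g (E w)))%:E =
    s%:E * (\int[P]_(w in B) (f w)%:E - \int[P]_(w in B) (g (E w))%:E))%E.
  move=> /measurable_sigma_of mB ifm.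
  have ifB : P.-integrable B (EFin \o f) by exact: integrableS ifm.
  have igB : P.-integrable B (EFin \o (g \o E)) by exact: integrableS ig.
  rewrite -(integralB_EFin mB ifB igB) -integralZl//.
  rewrite (_ : (fun w => _) = (EFin \o f) \- (EFin \o (g \o E)))%E//.
  exact: integrableB.
have swap (B : set Omega) (s : R) : sigma_of eps (A m) B ->
    (\int[P]_(w in B) (s * (Y m w - g (E w)))%:E =
    \int[P]_(w in B) (s * ((h \o E) w - g (E w)))%:E)%E.
  by move=> sB; rewrite !key// YE.
have bound (B : set Omega) (s : R) : `|s| <= 1 -> sigma_of eps (A m) B ->
    (forall w, B w -> `|Y m w - g (E w)| = s * (Y m w - g (E w))) ->
    (\int[P]_(w in B) (`|Y m w - g (E w)|)%:E <=
     \int[P]_(w in B) (`|(h \o E) w - g (E w)|)%:E)%E.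
  move=> s1 sB hB; have mB := measurable_sigma_of sB.
  rewrite (_ : (\int[P]_(w in B) (`|Y m w - g (E w)|)%:E =
    \int[P]_(w in B) (s * (Y m w - g (E w)))%:E)%E); last first.
    by apply: eq_integral => w; rewrite inE => /hB ->.
  rewrite swap//.
  have mhg : measurable_fun B (fun w => (h \o E) w - g (E w)).
    by apply: measurable_funTS; exact: measurable_funB.
  apply: le_trans (lee_abs _) _.
  apply: le_trans (le_abse_integral _ _ _) _ => //.
    by apply/measurable_EFinP; exact: measurable_funM.
  apply: ge0_le_integral => //.
  - apply: measurableT_comp => //.
    by apply/measurable_EFinP; exact: measurable_funM.
  - by apply/measurable_EFinP/measurableT_comp.
  - by move=> w _; rewrite /= lee_fin normrM ler_piMl.
rewrite !split_int//; apply: leeD.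
- apply: (bound D (-1)) => //; first by rewrite normrN1.
  by move=> w; rewrite /D /= => Dw; rewrite ler0_norm ?subr_le0 ?ltW// mulN1r.
- apply: (bound (~` D) 1) => //; first by rewrite normr1.
  move=> w; rewrite /D /= => /negP; rewrite -leNgt => Dw.
  by rewrite mul1r ger0_norm// subr_ge0.
Qed.

End L1_martingale.

(** * Limits in L1 *)

Section L1_limits.
Context (disp : measure_display) (Omega : measurableType disp) (R : realType).
Variable P : probability Omega R.
Implicit Types (p b e : R) (U V S : Omega -> R).

Lemma measurable_norm_powR U p : measurable_fun setT U ->
  measurable_fun setT (fun w => (`|U w| `^ p)%:E).
Proof.
move=> mU; apply/measurable_EFinP.
apply: (@measurableT_comp _ _ _ _ _ _ (@powR R ^~ p)) => //.
exact: measurableT_comp.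
Qed.

Lemma Lnorm_le_integral p b U : 0 < p -> 0 <= b ->
  ('N[P]_(p%:E)[EFin \o U] <= b%:E)%E ->
  (\int[P]_w (`|U w| `^ p)%:E <= (b `^ p)%:E)%E.
Proof.
move=> p0 b0 h.
have := @poweR_Lnorm _ _ _ P (EFin \o U) p (lt0r_neq0 p0).
move=> /= hE.
rewrite (_ : (\int[P]_w _)%E = (\int[P]_w (`|(EFin \o U) w| `^ p))%E)//.
rewrite -hE; rewrite -poweR_EFin; apply: gt0_ler_poweR => //; first exact: ltW.
- by rewrite in_itv/= leey andbT Lnorm_ge0.
- by rewrite in_itv/= leey andbT lee_fin.
Qed.

(** Lower semicontinuity of the p-norm along L1 limits. On the set where |U| <= n, convexity bounds
    |U|^p by |V|^p plus a multiple of |V - U|; the error vanishes for fixed n, and monotone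
    convergence then removes the truncation. *)
Lemma Lnorm_L1_limit p b U : 1 <= p -> 0 <= b -> measurable_fun setT U ->
  (forall e, 0 < e -> exists V, [/\ measurable_fun setT V,
     ('N[P]_(p%:E)[EFin \o V] <= b%:E)%E & (L1_dist P V U <= e%:E)%E]) ->
  ('N[P]_(p%:E)[EFin \o U] <= b%:E)%E.
Proof.
move=> p1 b0 mU hV.
have p0 : 0 < p by lra.
apply: Lnorm_le_powR => //.
pose A n := [set w | `|U w| <= n%:R].
have mA n : measurable (A n).
  rewrite -[X in measurable X]setTI.
  by apply: measurable_fun_ler => //; exact: measurableT_comp.
pose f n w : \bar R := ((fun w => (`|U w| `^ p)%:E) \_ (A n)) w.
have mf n : measurable_fun setT (f n).
  by apply/(measurable_restrictT _ (mA n)); apply: measurable_funTS; exact: measurable_norm_powR.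
have f0 n w : (0 <= f n w)%E.
  by rewrite /f patchE; case: ifP => // _; rewrite lee_fin powR_ge0.
have fnd w : {homo f ^~ w : m n / (m <= n)%N >-> (m <= n)%E}.
  move=> m n mn; rewrite /f !patchE; case: ifPn => [|_]; last exact: f0.
  rewrite inE /A /= => h; rewrite ifT//.
  by rewrite inE /A /= (le_trans h)// ler_nat.
have fcvg w : f ^~ w @ \oo --> (`|U w| `^ p)%:E.
  apply: cvg_near_cst.
  exists (Num.truncn `|U w|).+1 => // n /= hn.
  rewrite /f patchE ifT// inE /A /=; apply/ltW.
  apply: lt_le_trans (truncnS_gt _) _; by rewrite ler_nat.
have bound n : (\int[P]_w f n w <= (b `^ p)%:E)%E.
  apply/lee_addgt0Pr => e e0.
  pose c := p * n%:R `^ (p - 1) + 1.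
  have pn0 : 0 <= p * n%:R `^ (p - 1) by rewrite mulr_ge0 ?powR_ge0// ltW.
  have c0 : 0 < c by rewrite /c ltr_wpDl.
  have [V [mV Vb VU]] := hV (e / c) ltac:(by rewrite divr_gt0).
  have mVU : measurable_fun setT (fun w => (`|V w - U w|)%:E).
    by apply/measurable_EFinP/measurableT_comp => //; exact: measurable_funB.
  (* on A n the tangent inequality at |U| has a slope bounded by c *)
  apply: (@le_trans _ _ (\int[P]_w ((`|V w| `^ p)%:E + c%:E * (`|V w - U w|)%:E))%E).
    apply: ge0_le_integral => //.
    - by apply: emeasurable_funD; [exact: measurable_norm_powR|exact: emeasurable_funM].
    - move=> w _; rewrite -EFinM -EFinD /f patchE; case: ifPn => [|_]; last first.
        by rewrite lee_fin addr_ge0 ?powR_ge0// mulr_ge0// ltW.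
      rewrite inE /A /= => Un; rewrite lee_fin.
      have := powR_tangent p1 (normr_ge0 (V w)) (normr_ge0 (U w)).
      have le1 : `|U w| `^ (p - 1) <= n%:R `^ (p - 1).
        by apply: ge0_ler_powR; rewrite ?nnegrE//; lra.
      have le2 : - `|V w - U w| <= `|V w| - `|U w|.
        by rewrite lerNl opprB distrC lerB_dist.
      have u0 := powR_ge0 `|U w| (p - 1).
      have d0 := normr_ge0 (V w - U w).
      have : p * `|U w| `^ (p - 1) * (- `|V w - U w|) <=
         p * `|U w| `^ (p - 1) * (`|V w| - `|U w|).
        by rewrite ler_wpM2l// mulr_ge0// ltW.
      have : p * `|U w| `^ (p - 1) * `|V w - U w| <= c * `|V w - U w|.
        by rewrite ler_wpM2r// /c ler_wpDr// ler_wpM2l// ltW.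
      lra.
  rewrite ge0_integralD//; last 3 first.
  - exact: measurable_norm_powR.
  - by move=> w _; rewrite mule_ge0// lee_fin ltW.
  - exact: emeasurable_funM.
  rewrite ge0_integralZl//; last by rewrite lee_fin ltW.
  apply: leeD; first exact: Lnorm_le_integral.
  apply: (@le_trans _ _ (c%:E * (e / c)%:E)%E).
    by rewrite lee_wpmul2l// lee_fin ltW.
  by rewrite -EFinM mulrCA mulfV ?gt_eqF// mulr1.
have -> : (\int[P]_w (`|U w| `^ p)%:E = limn (fun n => \int[P]_w f n w))%E.
  rewrite -monotone_convergence//.
  by apply: eq_integral => w _; apply/esym/cvg_lim.
apply: lime_le; last by apply: nearW.
apply: ereal_nondecreasing_is_cvgn => m n mn.
by apply: ge0_le_integral => // w _; exact: fnd.
Qed.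

Lemma measurable_limn_einf (f : nat -> Omega -> \bar R) :
  (forall n, measurable_fun setT (f n)) ->
  measurable_fun setT (fun w => limn_einf (f ^~ w)).
Proof.
move=> mf.
have -> : (fun w => limn_einf (f ^~ w)) =
    (fun w => - limn_esup (fun n => - f n w))%E by [].
apply: measurableT_comp => //; apply: measurable_fun_limn_esup => n.
exact: measurableT_comp.
Qed.

Lemma limn_einf_le (u : nat -> \bar R) (c : \bar R) N :
  (forall n, (N <= n)%N -> (u n <= c)%E) -> (limn_einf u <= c)%E.
Proof.
move=> uc; rewrite limn_einf_lim; apply: lime_le; first exact: is_cvg_einfs.
apply: nearW => n; apply: ge_ereal_inf.
exists (u (maxn n N)); last by apply: uc; exact: leq_maxr.
by exists (maxn n N) => //=; exact: leq_maxl.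
Qed.

Lemma cvgn_of_summable_increments (u : nat -> R) :
  (\sum_(0 <= n <oo) (`|u n.+1 - u n|)%:E < +oo)%E -> cvgn u.
Proof.
move=> fin.
have -> : u = (fun n => u 0%N + series (telescope u) n).
  by apply/funext => n; exact: eq_sum_telescope.
apply: is_cvgD; first exact: is_cvg_cst.
apply: (@normed_cvg _ R^o).
apply: nondecreasing_is_cvgn.
  by apply: nondecreasing_series => n _ _ /=.
exists (fine (\sum_(0 <= n <oo) (`|u n.+1 - u n|)%:E)) => _ [n _ <-].
rewrite -lee_fin fineK; last first.
  by rewrite ge0_fin_numE// nneseries_ge0.
rewrite /series /= -sumEFin.
exact: (@nneseries_lim_ge _ (fun n => (`|u n.+1 - u n|)%:E) predT).
Qed.

(** Riesz-Fischer: a rapidly converging subsequence has almost surely summable increments, and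
    Fatou's lemma transfers the Cauchy bounds to its limit. *)
Lemma L1_complete (S : nat -> Omega -> R) :
  (forall n, P.-integrable setT (EFin \o S n)) ->
  (forall e, 0 < e -> exists N, forall m n, (N <= m)%N -> (N <= n)%N ->
     (L1_dist P (S m) (S n) <= e%:E)%E) ->
  exists2 U, P.-integrable setT (EFin \o U) &
    forall e, 0 < e -> exists N, forall n, (N <= n)%N ->
      (L1_dist P (S n) U <= e%:E)%E.
Proof.
move=> iS cS.
have mS n : measurable_fun setT (S n).
  by apply/measurable_EFinP; case/integrableP : (iS n).
have /choice[f hf] : forall k : nat, exists N, (k <= N)%N /\
     forall m n, (N <= m)%N -> (N <= n)%N ->
     (L1_dist P (S m) (S n) <= (1 / (2 ^ k.+1)%:R)%:E)%E.
  move=> k; have [|N hN] := cS (1 / (2 ^ k.+1)%:R).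
    by rewrite divr_gt0// ltr0n expn_gt0.
  exists (maxn k N); split; first exact: leq_maxl.
  by move=> m n; rewrite !geq_max => /andP[_ Nm] /andP[_ Nn]; exact: hN.
(* The running maximum makes the indices nondecreasing, so that both [g k] and [g k.+1] lie beyond
   the threshold [f k]. *)
pose g k := (\max_(j < k.+1) f j)%N.
have gf k : (f k <= g k)%N by exact: (@leq_bigmax _ (fun j : 'I_k.+1 => f j) ord_max).
have gS k : (g k <= g k.+1)%N by rewrite /g [X in (_ <= X)%N]big_ord_recr /= leq_maxl.
pose T k := S (g k).
have mT k : measurable_fun setT (T k) by exact: mS.
have mTd k : measurable_fun setT (fun w => (`|T k.+1 w - T k w|)%:E).
  by apply/measurable_EFinP/measurableT_comp => //; exact: measurable_funB.
have summable : (\int[P]_w (\sum_(0 <= k <oo) (`|T k.+1 w - T k w|)%:E) <= 1)%E.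
  rewrite integral_nneseries//.
  apply: le_trans (@epsilon_trick0 R 1 predT _); last by [].
  apply: lee_nneseries => [k _ _|k _]; first exact: integral_ge0.
  by apply: (hf k).2; [exact: (leq_trans (gf k))|exact: gf].
have aecvg : {ae P, forall w, cvgn (fun k => T k w)}.
  have mg : measurable_fun setT (fun w => \sum_(0 <= k <oo) (`|T k.+1 w - T k w|)%:E)%E.
    by apply: ge0_emeasurable_sum.
  have ig : P.-integrable setT (fun w => \sum_(0 <= k <oo) (`|T k.+1 w - T k w|)%:E)%E.
    apply/integrableP; split => //.
    under eq_integral do rewrite gee0_abs ?nneseries_ge0//.
    by rewrite (le_lt_trans summable)// ltry.
  have := integrable_ae measurableT ig; apply: filterS => w /(_ I).
  rewrite ge0_fin_numE ?nneseries_ge0// => h.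
  exact: (@cvgn_of_summable_increments (fun k => T k w)).
(* Taking the upper limit everywhere gives measurability without discarding a null set; it is the
   true limit almost surely. *)
pose U w := fine (limn_esup (fun k => (T k w)%:E)).
have mU : measurable_fun setT U.
  apply: (measurableT_comp (@fine_measurable R setT measurableT)).
  by apply: measurable_fun_limn_esup => k; exact/measurable_EFinP.
have aeU : {ae P, forall w, T ^~ w @ \oo --> U w}.
  move: aecvg; apply: filterS => w /cvg_ex[l Tl].
  rewrite /U (_ : limn_esup _ = l%:E)//.
  suff /cvg_limn_einf_sup[_ ->] : (fun k => (T k w)%:E) @ \oo --> l%:E by [].
  by apply: cvg_EFin => //; apply: nearW.
have dist_lim n c : (exists K, forall k, (K <= k)%N -> (L1_dist P (S n) (T k) <= c)%E) ->
    (L1_dist P (S n) U <= c)%E.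
  move=> [K hK].
  pose F k w := (`|S n w - T k w|)%:E.
  have mF k : measurable_fun setT (F k).
    by apply/measurable_EFinP/measurableT_comp => //; exact: measurable_funB.
  apply: (@le_trans _ _ (\int[P]_w limn_einf (F ^~ w))%E).
    apply: ae_ge0_le_integral => //.
    - by apply/measurable_EFinP/measurableT_comp => //; exact: measurable_funB.
    - move=> w _; rewrite limn_einf_lim; apply: lime_ge; first exact: is_cvg_einfs.
      by apply: nearW => k; apply: le_ereal_inf_tmp => _ [m _ <-]; rewrite lee_fin.
    - exact: measurable_limn_einf.
    - move: aeU; apply: filterS => w TU _.
      suff /cvg_limn_einf_sup[-> _] : F ^~ w @ \oo --> (`|S n w - U w|)%:E by [].
      apply: cvg_EFin; first by apply: nearW.
      by apply: cvg_norm; apply: cvgB => //; exact: cvg_cst.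
  apply: le_trans (fatou P measurableT mF _) _; first by move=> k w _; rewrite lee_fin.
  exact: limn_einf_le hK.
have main e : 0 < e -> exists N, forall n, (N <= n)%N -> (L1_dist P (S n) U <= e%:E)%E.
  move=> e0; have [N hN] := cS e e0; exists N => n Nn; apply: dist_lim.
  exists N => k Nk; apply: hN => //.
  by apply: leq_trans (gf k); exact: leq_trans (hf k).1.
exists U => //.
have [N /(_ N (leqnn _)) hN] := main 1 ltr01.
have iSU : P.-integrable setT (EFin \o (fun w => S N w - U w)).
  apply/integrableP; split; first by apply/measurable_EFinP; exact: measurable_funB.
  by apply: le_lt_trans hN _; rewrite ltry.
rewrite (_ : EFin \o U = (fun w => (EFin \o S N) w - ((EFin \o (fun w => S N w - U w)%R) w))%E).
  exact: integrableB.
by apply/funext => w /=; rewrite -EFinB; congr EFin; ring.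
Qed.

(** With Z = U - V, the tangent at c gives p c^(p-1) |Z| <= |Z|^p + (p - 1) c^p. Integrating against
    a probability and using b <= c leaves E|Z| <= c, for every c > b. *)
Lemma L1_dist_le_Lnorm p U V b : 1 <= p -> 0 <= b ->
  measurable_fun setT U -> measurable_fun setT V ->
  ('N[P]_(p%:E)[EFin \o (fun w => U w - V w)%R] <= b%:E)%E -> (L1_dist P U V <= b%:E)%E.
Proof.
move=> p1 b0 mU mV h.
have p0 : 0 < p by lra.
have mUV : measurable_fun setT (fun w => U w - V w) by exact: measurable_funB.
have := Lnorm_le_integral p0 b0 h.
move=> hi.
have m1 : measurable_fun setT (fun w => (`|U w - V w|)%:E).
  by apply/measurable_EFinP/measurableT_comp.
suff key s : 0 < s -> (L1_dist P U V <= (b + s)%:E)%E.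
  by apply/lee_addgt0Pr => s s0; rewrite -EFinD; exact: key.
(* Taking c above [b] keeps the slope positive even when [b] is 0, so it can be divided out. *)
move=> s0; set c := b + s.
have c0 : 0 < c by rewrite /c ltr_wpDl.
have cp : 0 < c `^ (p - 1) by exact: powR_gt0.
have cE : c `^ p = c `^ (p - 1) * c.
  by rewrite -[X in _ * X](powRr1 (ltW c0)) -powRDp ?subrK.
have pc0 : 0 < p * c `^ (p - 1) by rewrite mulr_gt0.
have p1c : 0 <= (p - 1) * c `^ p by rewrite mulr_ge0 ?powR_ge0// subr_ge0.
have step : ((p * c `^ (p - 1))%:E * L1_dist P U V <=
    (b `^ p)%:E + ((p - 1) * c `^ p)%:E)%E.
  rewrite /L1_dist -ge0_integralZl//; last by rewrite lee_fin ltW.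
  apply: (@le_trans _ _ (\int[P]_w ((`|U w - V w| `^ p)%:E + ((p - 1) * c `^ p)%:E))%E).
    apply: ge0_le_integral => //.
    - by move=> w _; rewrite mule_ge0// lee_fin// ltW.
    - exact: emeasurable_funM.
    - by apply: emeasurable_funD => //; exact: (measurable_norm_powR _ mUV).
    - move=> w _; rewrite -EFinM -EFinD lee_fin.
      have := powR_tangent p1 (normr_ge0 (U w - V w)) (ltW c0).
      rewrite cE; lra.
  rewrite ge0_integralD//; last exact: (measurable_norm_powR _ mUV).
  rewrite leeD// integral_cst// -[leRHS]mule1 lee_wpmul2l ?lee_fin//.
  exact: probability_le1.
have bc : b `^ p <= c `^ p.
  by apply: ge0_ler_powR; rewrite ?nnegrE /c; lra.
have : ((p * c `^ (p - 1))%:E * L1_dist P U V <= (p * c `^ (p - 1))%:E * c%:E)%E.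
  apply: (le_trans step); rewrite -EFinD -EFinM lee_fin -mulrA -cE; lra.
by rewrite lee_pmul2l// lte_fin.
Qed.

End L1_limits.

(** * Splitting the lattice into residue classes *)

Section residue_classes.
Variable d : nat.
Implicit Types i u : 'rV[int]_d.

(** The modulus is n + 1: at level j the class is taken with n = 2j, which gives the odd modulus 2j
    + 1. *)
Definition residue_class (n : nat) i : {ffun 'I_d -> 'I_n.+1} :=
  [ffun q => inord (absz (i ord0 q %% n.+1)%Z)].

(** Coordinates of congruent points differ by multiples of n + 1; if every difference were at most n
    in absolute value, all of them would vanish. *)
Lemma residue_class_far n i i' : residue_class n i = residue_class n i' ->
  i != i' -> exists q, (n < absz (i ord0 q - i' ord0 q))%N.
Proof.
move=> ii' neq; apply/not_existsP => close.
move/eqP: neq; apply; apply/rowP => q.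
have := close q; move/negP; rewrite -leqNgt => le_n.
have : residue_class n i q = residue_class n i' q by rewrite ii'.
rewrite !ffunE => /(congr1 val) /=.
have lt u : (absz (u ord0 q %% n.+1)%Z < n.+1)%N.
  have h : (0 <= (u ord0 q %% n.+1)%Z) by exact: modz_ge0.
  have : ((u ord0 q %% n.+1)%Z < n.+1) by exact: ltz_pmod.
  by rewrite -{1}(gez0_abs h) ltz_nat.
rewrite !inordK// => eqabs.
have eqmod : (i ord0 q = i' ord0 q %[mod n.+1])%Z.
  have := congr1 Posz eqabs.
  by rewrite !gez0_abs ?modz_ge0.
have /dvdzP[k kE] : (n.+1 %| i ord0 q - i' ord0 q)%Z by rewrite -eqz_mod_dvd; apply/eqP.
apply/eqP; rewrite -subr_eq0 kE.
move: le_n; rewrite kE abszM /= => le_n.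
have k0 : k = 0 by nia.
by rewrite k0 mul0r.
Qed.

Definition shifted_box (j : nat) i : set 'rV[int]_d := [set u | @box d j (u - i)].

Lemma box_coordinate j u q : @box d j u -> (absz (u ord0 q) <= j)%N.
Proof.
by move=> hu; apply: leq_trans hu; exact: (leq_bigmax (F := fun q => absz (u ord0 q))).
Qed.

(** A common point would put the two centres within 2j of each other in every coordinate, while
    distinct congruent centres are more than 2j apart in some coordinate. *)
Lemma shifted_box_disjoint j i i' : residue_class j.*2 i = residue_class j.*2 i' ->
  i != i' -> forall u, shifted_box j i u -> ~ shifted_box j i' u.
Proof.
move=> ii' neq u ui ui'.
have [q] := residue_class_far ii' neq.
have := box_coordinate q ui; have := box_coordinate q ui'.
rewrite 4!mxE.
have tri (x y z : int) : (absz (x - z) <= j)%N -> (absz (x - y) <= j)%N ->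
    (j.*2 < absz (y - z))%N -> False by lia.
exact: tri.
Qed.

(** This is the only source of the weights 4j + 4: the argument itself produces the side 2j + 1. *)
Lemma odd_side_le j : (j.*2.+1 <= 4 * j + 4)%N.
Proof. lia. Qed.

Lemma sub_box m n : (m <= n)%N -> @box d m `<=` @box d n.
Proof. by move=> mn u; rewrite /box /= => um; exact: leq_trans mn. Qed.

End residue_classes.

(** * Norms of finite families of coefficients *)

Section seq_norm.
Context (I : eqType) (R : realType).
Implicit Types (s : seq I) (a : I -> R) (q : R).

Definition seq_norm q s a : R := (\sum_(i <- s) `|a i| `^ q) `^ q^-1.

Lemma seq_norm_ge0 q s a : 0 <= seq_norm q s a.
Proof. exact: powR_ge0. Qed.

Lemma seq_norm_powR q s a : q != 0 -> seq_norm q s a `^ q = \sum_(i <- s) `|a i| `^ q.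
Proof.
by move=> q0; rewrite /seq_norm -powRrM mulVf// powRr1// sumr_ge0// => i _; exact: powR_ge0.
Qed.

Lemma seq_norm_partition (J : finType) (cl : I -> J) q s a : 1 <= q ->
  (0 < #|J|)%N ->
  \sum_c seq_norm q [seq i <- s | cl i == c] a <=
  #|J|%:R `^ (1 - q^-1) * seq_norm q s a.
Proof.
move=> q1 J0; have q0 : q != 0 by lra.
apply: (le_trans (@power_mean _ _ q (fun c => seq_norm q [seq i <- s | cl i == c] a) q1 _ J0)).
  by move=> c; exact: seq_norm_ge0.
rewrite ler_wpM2l ?powR_ge0// le_eqVlt; apply/orP; left; apply/eqP.
congr (_ `^ _); rewrite [RHS](partition_big cl predT)//=.
by apply: eq_bigr => c _; rewrite seq_norm_powR// big_filter.
Qed.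

(** Each |a i|^2 is at most the full sum t, so |a i|^q <= |a i|^2 t^(q/2 - 1). It lets a
    square-summable tail control the tail of order p. *)
Lemma seq_norm_le q s a : 2 <= q -> seq_norm q s a <= seq_norm 2 s a.
Proof.
move=> q2; have q0 : 0 < q by lra.
set t := \sum_(i <- s) `|a i| `^ 2.
have t0 : 0 <= t by rewrite sumr_ge0// => i _; exact: powR_ge0.
have le1 : \sum_(i <- s) `|a i| `^ q <= t `^ (q / 2).
  have -> : t `^ (q / 2) = t * t `^ (q / 2 - 1).
    have [->|tn0] := eqVneq t 0; first by rewrite powR0 ?mul0r//; lra.
    rewrite -[in LHS](subrKC 1 (q / 2)) powRDp ?powRr1//.
    by rewrite lt_neqAle eq_sym tn0.
  rewrite {1}/t mulr_suml [leLHS]big_seq [leRHS]big_seq; apply: ler_sum => i si.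
  have [->|ai0] := eqVneq (a i) 0.
    by rewrite normr0 powR0 ?mulr_ge0 ?powR_ge0// lt0r_neq0.
  have ai : 0 < `|a i| by rewrite normr_gt0.
  have ait : `|a i| `^ 2 <= t.
    rewrite /t (big_rem i)//= lerDl sumr_ge0// => k _; exact: powR_ge0.
  have -> : `|a i| `^ q = `|a i| `^ 2 * (`|a i| `^ 2) `^ (q / 2 - 1).
    by rewrite -powRrM -powRDp//; congr (_ `^ _); field.
  rewrite ler_wpM2l ?powR_ge0//; apply: ge0_ler_powR; rewrite ?nnegrE ?powR_ge0//; lra.
rewrite /seq_norm -/t.
apply: (@le_trans _ _ ((t `^ (q / 2)) `^ q^-1)).
  apply: ge0_ler_powR; rewrite ?nnegrE ?powR_ge0 ?invr_ge0 ?(ltW q0)//.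
  by rewrite sumr_ge0// => i _; exact: powR_ge0.
rewrite -powRrM (_ : q / 2 * q^-1 = 2^-1)//; by field; rewrite gt_eqF.
Qed.

End seq_norm.

Section Lnorm_sum.
Context (disp : measure_display) (Omega : measurableType disp) (R : realType).
Variable P : probability Omega R.

Lemma Lnorm_sum (J : Type) (r : seq J) (T : J -> Omega -> R) (p : R) : 1 <= p ->
  (forall c, measurable_fun setT (T c)) ->
  ('N[P]_(p%:E)[EFin \o (fun w => \sum_(c <- r) T c w)%R] <=
   \sum_(c <- r) 'N[P]_(p%:E)[EFin \o T c])%E.
Proof.
move=> p1 mT; elim: r => [|c r IH].
  rewrite big_nil (_ : EFin \o _ = cst 0%E) ?Lnorm0//; last first.
    by apply/funext => w /=; rewrite big_nil.
  by rewrite eqe; lra.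
rewrite big_cons (_ : (fun w => _) = (T c \+ (fun w => \sum_(c <- r) T c w))).
  apply: le_trans (minkowski_EFin P (mT c) _ p1) _; last by rewrite leeD2l.
  exact: measurable_sum.
by apply/funext => w /=; rewrite big_cons.
Qed.

End Lnorm_sum.

(** * Rosenthal's inequality at a fixed level *)

Section level.
Context (disp : measure_display) (Omega : measurableType disp) (R : realType).
Variable P : probability Omega R.
Variable d : nat.
Variable eps : 'rV[int]_d -> {RV P >-> R}.
Hypothesis eps_iid : iid eps.
Local Notation path := (g_sigma_algebraType (@coordinate_sets 'rV[int]_d R)).
Local Notation E := (random_path eps).

Lemma depends_on_shift j (xi : path -> R) i : depends_on (@box d j) xi ->
  depends_on (shifted_box j i) (xi \o shift_path i).
Proof.
move=> dxi x /=; rewrite -dxi -[RHS]dxi; congr xi; apply/funext => u.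
rewrite /restrict_path /shift_path; case: asboolP => // bu.
by rewrite (asboolT (_ : shifted_box j i (i + u)))// /shifted_box /= addrC addKr.
Qed.

Lemma measurable_shift_random_path (xi : path -> R) i :
  measurable_fun setT xi -> measurable_fun setT (fun w => xi (shift_path i (E w))).
Proof.
move=> mxi; apply: measurableT_comp => //.
by apply: measurableT_comp;
  [exact: measurable_shift_path|exact: measurable_random_path].
Qed.

Lemma integrable_shift (xi : path -> R) i : measurable_fun setT xi ->
  P.-integrable setT (EFin \o (xi \o E)) ->
  P.-integrable setT (fun w => (xi (shift_path i (E w)))%:E).
Proof.
move=> mxi /integrableP[_ fin]; apply/integrableP; split.
  by apply/measurable_EFinP; exact: measurable_shift_random_path.
rewrite (ge0_integral_shift_path eps_iid i (F := fun x => `|(xi x)%:E|%E))//.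
by apply: measurableT_comp => //; exact/measurable_EFinP.
Qed.

Lemma integral_shift (xi : path -> R) i : measurable_fun setT xi ->
  (\int[P]_w (xi (shift_path i (E w)))%:E = \int[P]_w (xi (E w))%:E)%E.
Proof.
move=> mxi.
have mxi' : measurable_fun setT (EFin \o xi) by exact/measurable_EFinP.
rewrite integralE [RHS]integralE; congr (_ - _)%E.
- transitivity (\int[P]_w (EFin \o xi)^\+%E (shift_path i (E w)))%E.
    by apply: eq_integral => w _; rewrite !funeposE.
  rewrite (ge0_integral_shift_path eps_iid i (F := (EFin \o xi)^\+%E))//.
    by apply: eq_integral => w _; rewrite !funeposE.
  exact: measurable_funepos.
- transitivity (\int[P]_w (EFin \o xi)^\-%E (shift_path i (E w)))%E.
    by apply: eq_integral => w _; rewrite !funenegE.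
  rewrite (ge0_integral_shift_path eps_iid i (F := (EFin \o xi)^\-%E))//.
    by apply: eq_integral => w _; rewrite !funenegE.
  exact: measurable_funeneg.
Qed.

(** The sum depends on the union of the boxes centred at the points of [s], and within one residue
    class this union is disjoint from the box centred at [i]. *)
Lemma independent_shift_sum j (xi : path -> R) (a : 'rV[int]_d -> R)
    (s : seq 'rV[int]_d) i c : measurable_fun setT xi ->
  depends_on (@box d j) xi ->
  (forall k, k \in s -> residue_class j.*2 k = c) -> residue_class j.*2 i = c ->
  i \notin s ->
  independent_pair P (fun w => \sum_(k <- s) a k * xi (shift_path k (E w)))
    (fun w => a i * xi (shift_path i (E w))).
Proof.
move=> mxi dxi sc ic iNs.
pose A : set 'rV[int]_d := \bigcup_(k in [set` s]) shifted_box j k.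
have ms k : measurable_fun setT (fun x : path => a k * xi (shift_path k x)).
  apply: measurable_funM => //; apply: measurableT_comp => //.
  exact: measurable_shift_path.
apply: (@independent_depends_on _ _ _ _ P eps eps_iid.1 A (shifted_box j i)
  (fun x => \sum_(k <- s) a k * xi (shift_path k x))
  (fun x => a i * xi (shift_path i x))) => //.
- apply/seteqP; split => // u [[k ks ku] iu].
  apply: (shifted_box_disjoint _ _ ku iu); first by rewrite sc.
  by apply: contraNneq iNs => <-.
- exact: measurable_sum.
- move=> x; rewrite [LHS]big_seq [RHS]big_seq; apply: eq_bigr => k ks; congr (_ * _).
  have dk := depends_on_shift k dxi.
  rewrite -[LHS]dk -[RHS]dk; congr xi; congr shift_path.
  by rewrite restrict_pathK// => u ku; exists k.
- by move=> x; congr (_ * _); exact: (depends_on_shift i dxi).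
Qed.

(** By invariance of the law under shifts, the q-th absolute moment of each summand is |a i|^q times
    the one at the site 0; the sums of moments are therefore exact powers of [seq_norm] times [n2]
    or [np]. *)
Lemma class_bound p j (xi : path -> R) (a : 'rV[int]_d -> R) (n2 np : R)
    (s : seq 'rV[int]_d) c : 2 <= p -> measurable_fun setT xi ->
  depends_on (@box d j) xi ->
  P.-integrable setT (EFin \o (xi \o E)) -> (\int[P]_w (xi (E w))%:E = 0)%E ->
  0 <= n2 -> 0 <= np ->
  ('N[P]_(2%:E)[EFin \o (xi \o E)] <= n2%:E)%E ->
  ('N[P]_(p%:E)[EFin \o (xi \o E)] <= np%:E)%E ->
  uniq s -> (forall k, k \in s -> residue_class j.*2 k = c) ->
  ('N[P]_(p%:E)[EFin \o (fun w => \sum_(k <- s) a k * xi (shift_path k (E w)))%R] <=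
   (145 / 10 * p / ln p * (seq_norm 2 s a * n2 + seq_norm p s a * np))%:E)%E.
Proof.
move=> p2 mxi dxi ixi xi0 n20 np0 h2 hp us sc.
have p0 : 0 < p by lra.
have mZ i : measurable_fun setT (fun w => a i * xi (shift_path i (E w))).
  by apply: measurable_funM => //; exact: measurable_shift_random_path.
pose Zm i := isMeasurableFun.Build _ _ _ _ _ (mZ i).
pose Z i : {RV P >-> R} := HB.pack (fun w => a i * xi (shift_path i (E w))) (Zm i).
have mom (q n : R) i : 0 < q -> 0 <= n -> ('N[P]_(q%:E)[EFin \o (xi \o E)] <= n%:E)%E ->
    (\int[P]_w (`|Z i w| `^ q)%:E <= (`|a i| `^ q * n `^ q)%:E)%E.
  move=> q0 n0 /(Lnorm_le_integral q0 n0) hq.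
  rewrite EFinM.
  have -> : (\int[P]_w (`|Z i w| `^ q)%:E =
      (`|a i| `^ q)%:E * \int[P]_w (`|xi (shift_path i (E w))| `^ q)%:E)%E.
    have mq := measurable_norm_powR q (measurable_shift_random_path i mxi).
    rewrite -ge0_integralZl//.
    by apply: eq_integral => w _; rewrite -EFinM -powRM// -normrM.
  apply: lee_wpmul2l; first by rewrite lee_fin powR_ge0.
  rewrite (ge0_integral_shift_path eps_iid i (F := fun x => (`|xi x| `^ q)%:E))//.
  exact: measurable_norm_powR.
apply: (@rosenthal _ _ _ P _ p s Z (fun i => `|a i| `^ 2 * n2 `^ 2)
  (fun i => `|a i| `^ p * np `^ p)) => //.
- move=> i s' si s's is'; apply: (@independent_shift_sum j xi a s' i c) => //.
  + by move=> k /s's /sc.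
  + exact: sc.
- move=> i _; rewrite (_ : EFin \o _ = (fun w => (a i)%:E * (xi (shift_path i (E w)))%:E)%E)//.
  by apply: integrableZl => //; exact: integrable_shift.
- move=> i _; under eq_integral do rewrite /= EFinM.
  by rewrite integralZl ?integral_shift ?xi0 ?mule0//; exact: integrable_shift.
- move=> i _; apply: le_trans (mom 2 n2 i _ n20 h2) => //.
  rewrite le_eqVlt; apply/orP; left; apply/eqP; apply: eq_integral => w _.
  by rewrite powR_mulrn// real_normK// num_real.
- by move=> i _; exact: mom.
- by rewrite mulr_ge0// seq_norm_ge0.
- by rewrite mulr_ge0// seq_norm_ge0.
- rewrite -powR_mulrn ?mulr_ge0 ?seq_norm_ge0// powRM ?seq_norm_ge0//.
  by rewrite seq_norm_powR// mulr_suml.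
- by rewrite powRM ?seq_norm_ge0// seq_norm_powR ?mulr_suml// gt_eqF.
Qed.

Lemma level_bound p j (xi : path -> R) (a : 'rV[int]_d -> R) (n2 np : R)
    (s : seq 'rV[int]_d) : 2 <= p -> measurable_fun setT xi ->
  depends_on (@box d j) xi ->
  P.-integrable setT (EFin \o (xi \o E)) -> (\int[P]_w (xi (E w))%:E = 0)%E ->
  0 <= n2 -> 0 <= np ->
  ('N[P]_(2%:E)[EFin \o (xi \o E)] <= n2%:E)%E ->
  ('N[P]_(p%:E)[EFin \o (xi \o E)] <= np%:E)%E ->
  uniq s ->
  ('N[P]_(p%:E)[EFin \o (fun w => \sum_(k <- s) a k * xi (shift_path k (E w)))%R] <=
   (145 / 10 * p / ln p * (seq_norm 2 s a * ((4 * j + 4)%N%:R `^ (d%:R / 2) * n2) +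
    seq_norm p s a * ((4 * j + 4)%N%:R `^ (d%:R * (1 - p^-1)) * np)))%:E)%E.
Proof.
move=> p2 mxi dxi ixi xi0 n20 np0 h2 hp us.
have p1 : 1 <= p by lra.
have C0 : 0 <= 145 / 10 * p / ln p.
  by have := ln_gt0_ge2 p2 => L0; rewrite divr_ge0 ?(ltW L0)//; lra.
pose cl := @residue_class d j.*2.
rewrite (_ : (fun w => _) = (fun w => \sum_c \sum_(k <- [seq k <- s | cl k == c])
    a k * xi (shift_path k (E w)))); last first.
  apply/funext => w; rewrite (partition_big cl predT)//=.
  by apply: eq_bigr => c _; rewrite big_filter.
apply: le_trans (Lnorm_sum _ _ p1 _) _.
  move=> c; apply: measurable_sum => k; apply: measurable_funM => //.
  exact: measurable_shift_random_path.
apply: (@le_trans _ _ (\sum_c (145 / 10 * p / ln p *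
    (seq_norm 2 [seq k <- s | cl k == c] a * n2 +
     seq_norm p [seq k <- s | cl k == c] a * np))%:E)%E).
  apply: lee_sum => c _; apply: (@class_bound p j xi a n2 np _ c) => //.
    exact: filter_uniq.
  by move=> k; rewrite mem_filter => /andP[/eqP].
rewrite sumEFin lee_fin -mulr_sumr ler_wpM2l// big_split/= -!mulr_suml.
have card : #|{ffun 'I_d -> 'I_(j.*2).+1}| = (j.*2.+1 ^ d)%N.
  by rewrite card_ffun !card_ord.
have card0 : (0 < #|{ffun 'I_d -> 'I_(j.*2).+1}|)%N by rewrite card expn_gt0.
(* The number of classes (2j+1)^d enters with the exponent 1 - 1/q of the power mean inequality; q =
   2 gives d/2, and q = p gives d(1 - 1/p). *)
have weight q : 1 <= q -> #|{ffun 'I_d -> 'I_(j.*2).+1}|%:R `^ (1 - q^-1) <=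
    (4 * j + 4)%N%:R `^ (d%:R * (1 - q^-1)) :> R.
  move=> q1; rewrite card natrX -powR_mulrn// -powRrM.
  apply: ge0_ler_powR; rewrite ?nnegrE//.
    by rewrite mulr_ge0// subr_ge0 invf_le1//; lra.
  by rewrite ler_nat odd_side_le.
apply: lerD.
- rewrite [leRHS]mulrA ler_wpM2r//.
  apply: le_trans (seq_norm_partition _ _ _ _ card0) _ => //; first by lra.
  rewrite mulrC ler_wpM2l ?seq_norm_ge0//.
  have := weight 2 ltac:(lra).
  by rewrite (_ : d%:R * (1 - 2^-1) = d%:R / 2 :> R)//; field.
- rewrite [leRHS]mulrA ler_wpM2r//.
  apply: le_trans (seq_norm_partition _ _ _ _ card0) _ => //.
  by rewrite mulrC ler_wpM2l ?seq_norm_ge0// weight.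
Qed.

End level.

(** * Bounds for finite sums *)

Section lnorm_seq_norm.
Context (I : choiceType) (R : realType).
Implicit Types (s : seq I) (a : I -> R) (q : R).

Lemma sum_le_esum s (b : I -> R) : uniq s -> (forall i, 0 <= b i) ->
  ((\sum_(i <- s) b i)%:E <= \esum_(i in [set: I]) (b i)%:E)%E.
Proof.
move=> us b0; apply: esum_ge; exists [set` s]; first by split.
by rewrite -fsbig_seq// sumEFin.
Qed.

Lemma seq_norm_le_lnorm q s a : 0 < q -> uniq s ->
  ((seq_norm q s a)%:E <= lnorm q a)%E.
Proof.
move=> q0 us; rewrite /seq_norm /lnorm -poweR_EFin.
apply: gt0_ler_poweR.
- by rewrite invr_ge0 ltW.
- rewrite in_itv/= leey andbT lee_fin sumr_ge0// => i _; exact: powR_ge0.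
- by rewrite in_itv/= leey andbT esum_ge0// => i _; rewrite lee_fin powR_ge0.
- by apply: sum_le_esum => // i; exact: powR_ge0.
Qed.

Lemma lnorm_gt0 q a i : 0 < q -> a i != 0 -> (0 < lnorm q a)%E.
Proof.
move=> q0 ai; apply: lt_le_trans (@seq_norm_le_lnorm q [:: i] a q0 _) => //.
rewrite lte_fin powR_gt0// big_seq1 powR_gt0//.
by rewrite normr_gt0.
Qed.

(** [F] carries all but [e] of the total mass, so adjoining any finite list disjoint from [F] would
    exceed the total if that list weighed more than [e]. *)
Lemma esum_tail (b : I -> R) e : 0 < e -> (forall i, 0 <= b i) ->
  (\esum_(i in [set: I]) (b i)%:E < +oo)%E ->
  exists F : {fset I}, forall s, uniq s -> (forall i, i \in s -> i \notin F) ->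
    \sum_(i <- s) b i <= e.
Proof.
move=> e0 b0 fin.
have ge0 : (0 <= \esum_(i in [set: I]) (b i)%:E)%E.
  by apply: esum_ge0 => i _; rewrite lee_fin.
have fn : \esum_(i in [set: I]) (b i)%:E \is a fin_num by rewrite ge0_fin_numE.
have [_ [A [finA _] <-] hA] := ub_ereal_sup_adherent e0 fn.
exists (fset_set A) => s us sA.
have uAs : uniq (enum_fset (fset_set A) ++ s).
  rewrite cat_uniq us fset_uniq andbT/=; apply/hasPn => i /sA; exact.
have := sum_le_esum uAs b0; rewrite big_cat/=.
move: hA; rewrite fsbig_finite//= sumEFin.
rewrite -/(esum _ _) -(fineK fn) -EFinB lte_fin lee_fin; lra.
Qed.

End lnorm_seq_norm.

Section field.
Context (disp : measure_display) (Omega : measurableType disp) (R : realType).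
Variable P : probability Omega R.
Variable d : nat.
Variable eps : 'rV[int]_d -> {RV P >-> R}.
Hypothesis eps_iid : iid eps.
Local Notation path := (g_sigma_algebraType (@coordinate_sets 'rV[int]_d R)).
Local Notation E := (random_path eps).

Lemma L1_dist_sum (I : Type) (s : seq I) (a : I -> R) (f g : I -> Omega -> R) :
  (forall i, measurable_fun setT (f i)) -> (forall i, measurable_fun setT (g i)) ->
  (L1_dist P (fun w => \sum_(i <- s) a i * f i w)%R
     (fun w => \sum_(i <- s) a i * g i w)%R <=
   \sum_(i <- s) (`|a i|%:E * L1_dist P (f i) (g i)))%E.
Proof.
move=> mf mg.
have mfg i : measurable_fun setT (fun w => (`|f i w - g i w|)%:E).
  by apply/measurable_EFinP/measurableT_comp => //; exact: measurable_funB.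
rewrite /L1_dist.
under [leRHS]eq_bigr do rewrite -ge0_integralZl//.
rewrite -ge0_integral_sum//; last by move=> i; exact: emeasurable_funM.
apply: ge0_le_integral => //.
- apply/measurable_EFinP/measurableT_comp => //; apply: measurable_funB;
    by apply: measurable_sum => i; exact: measurable_funM.
- by apply: emeasurable_sum => i; exact: emeasurable_funM.
- move=> w _; under [leRHS]eq_bigr do rewrite -EFinM.
  rewrite sumEFin lee_fin -sumrB; apply: le_trans (ler_norm_sum _ _ _) _.
  by apply: ler_sum => i _; rewrite -mulrBr normrM.
Qed.

(** The function h is replaced at every site by the level-J approximation, whose increments are
    bounded level by level; these bounds are uniform in J, so they survive the L1 limit. *)
Lemma finite_sum_bound (p : R) (h : path -> R) (Y : nat -> Omega -> R)
    (a : 'rV[int]_d -> R) (s : seq 'rV[int]_d) (S2 Sp : R) :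
  2 <= p -> measurable_fun setT h ->
  P.-integrable setT (EFin \o (h \o E)) -> (\int[P]_w (h (E w))%:E = 0)%E ->
  (forall j, is_cond_exp P (sigma_of eps (@box d j)) (h \o E) (Y j)) ->
  (\sum_(0 <= j <oo) (((4 * j + 4)%N%:R `^ (d%:R / 2))%:E *
      'N[P]_2%:E[EFin \o projection_increment Y j]) <= S2%:E)%E ->
  (\sum_(0 <= j <oo) (((4 * j + 4)%N%:R `^ (d%:R * (1 - p^-1)))%:E *
      'N[P]_(p%:E)[EFin \o projection_increment Y j]) <= Sp%:E)%E ->
  uniq s ->
  ('N[P]_(p%:E)[EFin \o (fun w => \sum_(k <- s) a k * h (shift_path k (E w)))%R] <=
   (145 / 10 * p / ln p * (seq_norm 2 s a * S2 + seq_norm p s a * Sp))%:E)%E.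
Proof.
move=> p2 mh ih h0 hY hS2 hSp us.
have p1 : 1 <= p by lra.
have C0 : 0 <= 145 / 10 * p / ln p.
  by have := ln_gt0_ge2 p2 => L0; rewrite divr_ge0 ?(ltW L0)//; lra.
have /choice[phi hphi] : forall j, exists phi : path -> R,
    [/\ measurable_fun setT phi, depends_on (@box d j) phi &
      forall w, Y j w = phi (E w)].
  move=> j; have [mY _ _] := hY j.
  by have [phi [? ?] ?] := sigma_of_factor mY; exists phi.
have mphi j : measurable_fun setT (phi j) by have [] := hphi j.
have YE j : Y j = phi j \o E by apply/funext => w; have [_ _ ->] := hphi j.
(* The increment as a function on path space; composed with [shift_path k] it plays the role of
   X_{k,j}. *)
pose xi j x := if j is j'.+1 then phi j x - phi j' x else phi 0%N x.
have mxi j : measurable_fun setT (xi j : path -> R).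
  by case: j => [|j]; [exact: mphi|exact: measurable_funB].
have dxi j : depends_on (@box d j) (xi j).
  case: j => [|j] x /=; first by have [_ -> _] := hphi 0%N.
  have [_ -> _] := hphi j.+1; congr (_ - _).
  have [_ dj _] := hphi j.
  by rewrite -dj restrict_pathK ?dj//; exact: sub_box.
have XE j : projection_increment Y j = xi j \o E.
  by apply/funext => w; case: j => [|j] /=; rewrite !YE.
have iY j : P.-integrable setT (EFin \o (phi j \o E)).
  by rewrite -YE; have [] := hY j.
(* The conditional expectation inherits the mean of X_0 by testing it on the whole space. *)
have Y0 j : (\int[P]_w (phi j (E w))%:E = 0)%E.
  have [_ _ cY] := hY j.
  have := cY setT; rewrite YE /= => ->; first exact: h0.
  have sA : sigma_algebra setT (sigma_of eps (@box d j)) by exact: smallest_sigma_algebra.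
  by rewrite -setC0 -setTD; case: sA => s0 sC _; exact: sC.
have ixi j : P.-integrable setT (EFin \o (xi j \o E)).
  case: j => [|j]; first exact: iY.
  rewrite (_ : _ \o _ = (EFin \o (phi j.+1 \o E)) \- (EFin \o (phi j \o E)))%E//.
  exact: integrableB.
have xi0 j : (\int[P]_w (xi j (E w))%:E = 0)%E.
  case: j => [|j]; first exact: Y0.
  rewrite /xi; under eq_integral do rewrite EFinB.
  by rewrite integralB_EFin// ?Y0 ?subee//; exact: iY.
(* Weights at least 1 make each norm no larger than its weighted term, so a finite series forces
   every norm to be finite. *)
have w0 (r : R) j : 0 <= r -> 1 <= (4 * j + 4)%N%:R `^ r.
  move=> r0; rewrite -[leLHS](powRr0 (4 * j + 4)%N%:R); apply: ler_powR => //.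
  by rewrite ler1n addn_gt0 orbT.
pose n q j := fine ('N[P]_(q%:E)[EFin \o projection_increment Y j])%E.
have key (q r S : R) : 0 <= r ->
    (\sum_(0 <= j <oo) (((4 * j + 4)%N%:R `^ r)%:E *
      'N[P]_(q%:E)[EFin \o projection_increment Y j]) <= S%:E)%E ->
    (forall j, 'N[P]_(q%:E)[EFin \o projection_increment Y j] = (n q j)%:E)%E /\
    forall J, \sum_(j < J) (4 * j + 4)%N%:R `^ r * n q j <= S.
  move=> r0 hS.
  have t0 j : (0 <= ((4 * j + 4)%N%:R `^ r)%:E *
      'N[P]_(q%:E)[EFin \o projection_increment Y j])%E.
    by rewrite mule_ge0 ?Lnorm_ge0// lee_fin powR_ge0.
  have part J : (\sum_(0 <= j < J) (((4 * j + 4)%N%:R `^ r)%:E *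
      'N[P]_(q%:E)[EFin \o projection_increment Y j]) <= S%:E)%E.
    apply: le_trans hS; apply: (@nneseries_lim_ge _ (fun j => ((4 * j + 4)%N%:R `^ r)%:E *
      'N[P]_(q%:E)[EFin \o projection_increment Y j])%E predT).
    by move=> j _ _.
  have nE j : ('N[P]_(q%:E)[EFin \o projection_increment Y j] = (n q j)%:E)%E.
    rewrite fineK// ge0_fin_numE ?Lnorm_ge0//.
    apply: (@le_lt_trans _ _ S%:E); last by rewrite ltry.
    apply: le_trans (part j.+1).
    rewrite big_nat_recr//=.
    apply: (@le_trans _ _ (((4 * j + 4)%N%:R `^ r)%:E *
      'N[P]_(q%:E)[EFin \o projection_increment Y j])%E).
      by rewrite -[leLHS]mul1e lee_wpmul2r ?Lnorm_ge0// lee_fin w0.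
    by rewrite leeDr// sume_ge0.
  split=> // J; rewrite -lee_fin; apply: le_trans (part J).
  rewrite big_mkord -sumEFin; apply: lee_sum => j _.
  by rewrite nE EFinM.
have r20 : 0 <= d%:R / 2 :> R by rewrite divr_ge0.
have rp0 : 0 <= d%:R * (1 - p^-1).
  by rewrite mulr_ge0// subr_ge0 invf_le1//; lra.
have [n2E sum2] := key 2 _ S2 r20 hS2.
have [npE sump] := key p _ Sp rp0 hSp.
have n_ge0 q j : 0 <= n q j by rewrite fine_ge0// Lnorm_ge0.
set b := _ * (_ + _).
have b0 : 0 <= b.
  have := sum2 0%N; have := sump 0%N; rewrite !big_ord0 => Sp0 S20.
  by rewrite mulr_ge0// addr_ge0// mulr_ge0// seq_norm_ge0.
have mhs k : measurable_fun setT (fun w => h (shift_path k (E w))).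
  exact: measurable_shift_random_path.
have mphis j k : measurable_fun setT (fun w => phi j (shift_path k (E w))).
  exact: measurable_shift_random_path.
apply: Lnorm_L1_limit => //.
  by apply: measurable_sum => k; exact: measurable_funM.
move=> e e0.
(* Approximating h within e / A at each site gives a total error at most e; the added 1 keeps A
   positive. *)
pose A := \sum_(k <- s) `|a k| + 1.
have A0 : 0 < A by rewrite ltr_wpDl// sumr_ge0.
have cov (u : 'rV[int]_d) : exists n, @box d n u by exists (supnorm u); rewrite /box /=.
have [J hJ] := @L1_martingale_convergence _ _ _ _ P eps (@box d) (@sub_box d)
  cov h Y mh ih hY (e / A) ltac:(by rewrite divr_gt0).
exists (fun w => \sum_(k <- s) a k * phi J (shift_path k (E w))); split.
- by apply: measurable_sum => k; exact: measurable_funM.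
(* [phi J] telescopes into the increments of levels 0 to J, after which Minkowski's inequality
   applies over the levels. *)
- have -> : (fun w => \sum_(k <- s) a k * phi J (shift_path k (E w))) =
      (fun w => \sum_(j < J.+1) \sum_(k <- s) a k * xi j (shift_path k (E w))).
    apply/funext => w; rewrite exchange_big/=; apply: eq_bigr => k _.
    rewrite -mulr_sumr; congr (_ * _).
    elim: J {hJ} => [|J IH]; first by rewrite big_ord1.
    by rewrite big_ord_recr/= -IH subrKC.
  apply: le_trans (Lnorm_sum _ _ p1 _) _.
    move=> j; apply: measurable_sum => k; apply: measurable_funM => //.
    exact: measurable_shift_random_path.
  apply: (@le_trans _ _ (\sum_(j < J.+1) (145 / 10 * p / ln p *
     (seq_norm 2 s a * ((4 * j + 4)%N%:R `^ (d%:R / 2) * n 2 j) +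
      seq_norm p s a * ((4 * j + 4)%N%:R `^ (d%:R * (1 - p^-1)) * n p j)))%:E)%E).
    apply: lee_sum => j _; apply: level_bound => //.
    + by rewrite -XE n2E.
    + by rewrite -XE npE.
  rewrite sumEFin lee_fin -mulr_sumr ler_wpM2l// big_split/= -!mulr_sumr.
  by apply: lerD; rewrite ler_wpM2l ?seq_norm_ge0//; [exact: sum2|exact: sump].
- apply: le_trans (L1_dist_sum s a (mphis J) mhs) _.
  apply: (@le_trans _ _ (\sum_(k <- s) (`|a k| * (e / A))%:E)%E).
    apply: lee_sum => k _; rewrite EFinM lee_wpmul2l//.
    have := hJ J (leqnn J); rewrite YE => /(le_trans _); apply.
    rewrite /L1_dist (ge0_integral_shift_path eps_iid k (F := fun x => (`|phi J x - h x|)%:E))//.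
    by apply/measurable_EFinP/measurableT_comp => //; exact: measurable_funB.
  rewrite sumEFin lee_fin -mulr_suml mulrCA ler_piMr ?(ltW e0)//.
  by rewrite ler_pdivrMr// mul1r lerDl.
Qed.

End field.

(** * Sums over boxes and their L1 limits *)

Section L1_sum.
Context (disp : measure_display) (Omega : measurableType disp) (R : realType).
Variable P : probability Omega R.
Variable d : nat.

Lemma is_L1_sum_dist (Z : 'rV[int]_d -> Omega -> R) (S : Omega -> R) :
  is_L1_sum P Z S -> forall e : R, 0 < e -> exists n, forall m, (n <= m)%N ->
    (L1_dist P (fun w => \sum_(i <- fset_set (@box d m)) Z i w)%R S <= e%:E)%E.
Proof.
move=> [_ cZ] e e0; have [N hN] := cvg_EFin0_near cZ e0.
exists N => m /hN; rewrite Lnorm1 /L1_dist.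
rewrite (_ : (\int[P]_w `|_|)%E =
  (\int[P]_w (`|\sum_(i <- fset_set (@box d m)) Z i w - S w|)%:E)%E)//.
by apply: eq_integral => w _; rewrite fsbig_finite//; exact: finite_box.
Qed.

Lemma is_L1_sum_of_dist (Z : 'rV[int]_d -> Omega -> R) (S : Omega -> R) :
  P.-integrable setT (EFin \o S) ->
  (forall e : R, 0 < e -> exists n, forall m, (n <= m)%N ->
    (L1_dist P (fun w => \sum_(i <- fset_set (@box d m)) Z i w)%R S <= e%:E)%E) ->
  is_L1_sum P Z S.
Proof.
move=> iS hS; split => //.
have NE m : ('N[P]_1[(fun w => (\sum_(i \in @box d m) Z i w - S w)%R%:E)] =
    L1_dist P (fun w => \sum_(i <- fset_set (@box d m)) Z i w)%R S)%E.
  rewrite Lnorm1 /L1_dist.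
  by apply: eq_integral => w _; rewrite fsbig_finite//; exact: finite_box.
apply/fine_cvgP; split.
  have [N hN] := hS 1 ltr01; exists N => // m /= /hN h.
  rewrite NE ge0_fin_numE; last exact: integral_ge0.
  by rewrite (le_lt_trans h)// ltry.
apply/cvgrPdist_le => e e0; have [N hN] := hS e e0; exists N => // m /= /hN h.
rewrite sub0r normrN /= NE ger0_norm; last by rewrite fine_ge0// integral_ge0.
rewrite -lee_fin fineK// ge0_fin_numE; last exact: integral_ge0.
by rewrite (le_lt_trans h)// ltry.
Qed.

End L1_sum.

Lemma integrable_of_Lnorm (disp : measure_display) (Omega : measurableType disp)
    (R : realType) (P : probability Omega R) (p : R) (X : Omega -> R) :
  1 <= p -> measurable_fun setT X -> ('N[P]_(p%:E)[EFin \o X] < +oo)%E ->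
  P.-integrable setT (EFin \o X).
Proof.
move=> p1 mX Xp; apply/integrableP; split; first exact/measurable_EFinP.
have N0 : (0 <= 'N[P]_(p%:E)[EFin \o X])%E by exact: Lnorm_ge0.
have hX : ('N[P]_(p%:E)[EFin \o (fun w => X w - (cst 0 : Omega -> R) w)%R] <=
    (fine 'N[P]_(p%:E)[EFin \o X])%:E)%E.
  rewrite fineK ?ge0_fin_numE// (_ : (fun w => _) = X)//.
  by apply/funext => w /=; rewrite subr0.
have := L1_dist_le_Lnorm p1 (fine_ge0 N0) mX (measurable_cst _) hX.
rewrite /L1_dist; under eq_integral do rewrite subr0.
by move=> /le_lt_trans; apply; rewrite ltry.
Qed.

(** The series of increments may diverge, so the right-hand side lives in the extended reals and
    existence of the sum is tied to its finiteness. The L1 sum is determined only up to null sets,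
    whence the quantification over all its versions. *)
Theorem theorem1p4 (R : realType) (disp : measure_display)
    (Omega : measurableType disp) (P : probability Omega R)
    (d : nat) (hd : (1 <= d)%N) (p : R) (hp : 2 <= p)
    (eps : 'rV[int]_d -> {RV P >-> R}) (heps : iid eps)
    (f : ('rV[int]_d -> R) -> R)
    (hf : measurable_fun setT
       (f : g_sigma_algebraType (@coordinate_sets 'rV[int]_d R) -> R))
    (X : 'rV[int]_d -> Omega -> R) (hX : X = shift_field eps f)
    (hXp : forall j, ('N[P]_(p%:E)[EFin \o X j] < +oo)%E)
    (hX0 : forall j, ('E_P[X j] = 0)%E)
    (a : 'rV[int]_d -> R) (ha : (lnorm 2 a < +oo)%E)
    (Y : nat -> Omega -> R)
    (hY : forall j, is_cond_exp P (sigma_of eps (@box d j)) (X 0) (Y j)) :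
  let C := 145 / 10 * p / ln p in
  let X0 := projection_increment Y in
  let bound :=
    (C%:E * lnorm 2 a *
       (\sum_(0 <= j <oo)
          (((4 * j + 4)%N%:R `^ (d%:R / 2))%:E * 'N[P]_2%:E[EFin \o X0 j]))
     + C%:E * lnorm p a *
       (\sum_(0 <= j <oo)
          (((4 * j + 4)%N%:R `^ (d%:R * (1 - p^-1)))%:E
            * 'N[P]_(p%:E)[EFin \o X0 j])))%E in
  let Z := fun (i : 'rV[int]_d) (w : Omega) => a i * X i w in
  ((bound < +oo)%E -> exists S : Omega -> R, is_L1_sum P Z S) /\
  (forall S : Omega -> R, is_L1_sum P Z S ->
     ('N[P]_(p%:E)[EFin \o S] <= bound)%E).
Proof.
move=> C X0 bound Z.
have p1 : 1 <= p by lra.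
have p0 : 0 < p by lra.
have C0 : 0 < C by rewrite divr_gt0 ?ln_gt0_ge2//; lra.
pose path := g_sigma_algebraType (@coordinate_sets 'rV[int]_d R).
(* [f] reads the innovation at j - i in its i-th slot; reflecting the index turns this into a
   function of the path shifted by j. *)
pose h (x : path) : R := f (fun i => x (- i)).
pose E := random_path eps.
have mh : measurable_fun setT h.
  pose refl (x : path) : path := fun i => x (- i).
  apply: (@measurableT_comp _ _ _ _ _ _ (f : path -> R) _ refl) => //.
  by apply: measurable_to_path => u; exact: measurable_coordinate.
have XE j w : X j w = h (shift_path j (E w)) by rewrite hX.
have X0E : X 0 = h \o E.
  apply/funext => w; rewrite XE /=; congr h; apply/funext => u.
  by rewrite /shift_path add0r.
have mX j : measurable_fun setT (X j).
  rewrite (_ : X j = fun w => h (shift_path j (E w))).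
    exact: measurable_shift_random_path.
  by apply/funext => w; rewrite XE.
have ih : P.-integrable setT (EFin \o (h \o E)).
  by rewrite -X0E; apply: (integrable_of_Lnorm p1).
have h0 : (\int[P]_w (h (E w))%:E = 0)%E.
  by have := hX0 0; rewrite unlock X0E.
have hY' j : is_cond_exp P (sigma_of eps (@box d j)) (h \o E) (Y j).
  by rewrite -X0E.
pose T2 := (\sum_(0 <= j <oo)
  (((4 * j + 4)%N%:R `^ (d%:R / 2))%:E * 'N[P]_2%:E[EFin \o X0 j]))%E.
pose Tp := (\sum_(0 <= j <oo)
  (((4 * j + 4)%N%:R `^ (d%:R * (1 - p^-1)))%:E * 'N[P]_(p%:E)[EFin \o X0 j]))%E.
have boundE : bound = (C%:E * lnorm 2 a * T2 + C%:E * lnorm p a * Tp)%E by [].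
have T20 : (0 <= T2)%E.
  by apply: nneseries_ge0 => j _ _; rewrite mule_ge0 ?Lnorm_ge0// lee_fin powR_ge0.
have Tp0 : (0 <= Tp)%E.
  by apply: nneseries_ge0 => j _ _; rewrite mule_ge0 ?Lnorm_ge0// lee_fin powR_ge0.
have fsb (S2 Sp : R) s : (T2 <= S2%:E)%E -> (Tp <= Sp%:E)%E -> uniq s ->
    ('N[P]_(p%:E)[EFin \o (fun w => \sum_(i <- s) Z i w)%R] <=
     (C * (seq_norm 2 s a * S2 + seq_norm p s a * Sp))%:E)%E.
  move=> hS2 hSp us.
  rewrite (_ : (fun w => _) = (fun w => \sum_(i <- s) a i * h (shift_path i (E w)))).
    exact: (@finite_sum_bound _ _ _ P d eps heps p h Y a s S2 Sp).
  by apply/funext => w; apply: eq_bigr => i _; rewrite /Z XE.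
clearbody bound T2 Tp C.
have l0 q : (0 <= lnorm q a)%E by exact: poweR_ge0.
have CE0 : (0 <= C%:E)%E by rewrite lee_fin ltW.
have bound0 : (0 <= bound)%E by rewrite boundE adde_ge0// !mule_ge0.
have mZ i : measurable_fun setT (Z i) by exact: measurable_funM.
pose ZS k w := \sum_(i <- fset_set (@box d k)) Z i w.
have mZS k : measurable_fun setT (ZS k) by exact: measurable_sum.
(* A bound uniform over boxes passes to every L1 sum. *)
have reduce (b : R) : 0 <= b -> (b%:E <= bound)%E ->
    (forall k, ('N[P]_(p%:E)[EFin \o ZS k] <= b%:E)%E) ->
    forall S, is_L1_sum P Z S -> ('N[P]_(p%:E)[EFin \o S] <= bound)%E.
  move=> b0 bb hb S ZSsum; apply: le_trans bb.
  have mS : measurable_fun setT S.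
    by apply/measurable_EFinP; case: ZSsum => /integrableP[].
  apply: Lnorm_L1_limit => // e e0.
  have [n hn] := is_L1_sum_dist ZSsum e0.
  by exists (ZS n); split => //; exact: hn.
(* The zero family is separated because 0 times +oo is 0 here: a finite bound would then say nothing
   about the two series. *)
have [aE|/existsNP[i0 ai0]] := pselect (forall i, a i = 0).
  have ZS0 k : ZS k = cst 0.
    by apply/funext => w; apply: big1 => i _; rewrite /Z aE mul0r.
  split.
    move=> _; exists (cst 0); apply: is_L1_sum_of_dist.
      exact: finite_measure_integrable_cst.
    move=> e e0; exists 0%N => m _; rewrite -/(ZS m) ZS0 /L1_dist.
    by under eq_integral do rewrite subrr normr0; rewrite integral0 lee_fin ltW.
  apply: (reduce 0) => // k.
  rewrite ZS0 (_ : EFin \o _ = cst 0%E)// Lnorm0//.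
  by rewrite eqe gt_eqF.
have {}ai0 : a i0 != 0 by exact/eqP.
have l2 : (0 < lnorm 2 a)%E by exact: (lnorm_gt0 _ ai0).
have lp : (0 < lnorm p a)%E by exact: (lnorm_gt0 _ ai0).
have [bfin|] := boolP (bound < +oo)%E; last first.
  move=> binf; split => // S _.
  by move: binf; rewrite -leNgt leye_eq => /eqP ->; rewrite leey.
(* A positive factor in front of an infinite series would make the bound infinite, so both series
   are finite. *)
have finT (l T : \bar R) : (0 < l)%E -> (0 <= T)%E -> (C%:E * l * T < +oo)%E ->
    (T <= (fine T)%:E)%E.
  move=> l_gt0 T0 lt.
  rewrite fineK// ge0_fin_numE//; rewrite ltNge leye_eq; apply/negP => /eqP TE.
  by move: lt; rewrite TE gt0_muley// mule_gt0.
have T2f : (T2 <= (fine T2)%:E)%E.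
  apply: (finT (lnorm 2 a)) => //; apply: le_lt_trans bfin.
  by rewrite boundE leeDl// !mule_ge0.
have Tpf : (Tp <= (fine Tp)%:E)%E.
  apply: (finT (lnorm p a)) => //; apply: le_lt_trans bfin.
  by rewrite boundE leeDr// !mule_ge0.
have T2r : 0 <= fine T2 by exact: fine_ge0.
have Tpr : 0 <= fine Tp by exact: fine_ge0.
have {}fsb s := fsb _ _ s T2f Tpf.
split; last first.
  apply: (reduce (fine bound)); first exact: fine_ge0.
    by rewrite fineK// ge0_fin_numE.
  move=> k; apply: (le_trans (fsb _ (fset_uniq _))).
  rewrite fineK ?ge0_fin_numE// boundE mulrDr EFinD !EFinM.
  have T2fE : (fine T2)%:E = T2.
    by apply/eqP; rewrite eq_le T2f andbT fineK// ge0_fin_numE// (le_lt_trans T2f)// ltry.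
  have TpfE : (fine Tp)%:E = Tp.
    by apply/eqP; rewrite eq_le Tpf andbT fineK// ge0_fin_numE// (le_lt_trans Tpf)// ltry.
  rewrite T2fE TpfE !muleA; apply: leeD; apply: lee_wpmul2r => //;
    by apply: lee_wpmul2l => //; apply: seq_norm_le_lnorm => //; exact: fset_uniq.
move=> _.
(* If the l^2 tail of [a], hence also its l^p tail, is at most e / D, the finite-sum bound is at
   most e; the added 1 avoids division by 0. *)
pose D := C * (fine T2 + fine Tp) + 1.
have D0 : 0 < D by rewrite ltr_wpDl// mulr_ge0 ?addr_ge0// ltW.
have cauchy (e : R) : 0 < e -> exists N, forall m n, (N <= m)%N -> (N <= n)%N ->
    (L1_dist P (ZS m) (ZS n) <= e%:E)%E.
  move=> e0.
  have e'0 : 0 < (e / D) `^ 2 by rewrite powR_gt0// divr_gt0.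
  have [||F hF] := @esum_tail _ _ (fun i => `|a i| `^ 2) _ e'0.
  - by move=> i; exact: powR_ge0.
  - have := ha; rewrite /lnorm.
    apply: lty_poweRy; by rewrite invr_eq0.
  (* The box of radius [N] contains [F], so sites lying between two larger boxes avoid [F] and only
     the tail of [a] contributes. *)
  pose N := (\max_(i <- F) supnorm i)%N.
  have FN i : i \in F -> @box d N i.
    by move=> iF; rewrite /box /=; exact: leq_bigmax_seq.
  suff half m n : (N <= n)%N -> (n <= m)%N -> (L1_dist P (ZS m) (ZS n) <= e%:E)%E.
    exists N => m n Nm Nn; have [nm|/ltnW mn] := leqP n m; first exact: half.
    by rewrite L1_distC; exact: half.
  move=> Nn nm.
  pose s := [seq i <- fset_set (@box d m) | i \notin fset_set (@box d n)].
  have us : uniq s by rewrite filter_uniq// fset_uniq.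
  have ZSE w : ZS m w - ZS n w = \sum_(i <- s) Z i w.
    rewrite /ZS (bigID (mem (fset_set (@box d n))))/= big_filter.
    rewrite -[X in X + _ - _]big_filter (perm_big (fset_set (@box d n))).
      by rewrite addrC addKr.
    apply: uniq_perm; rewrite ?filter_uniq ?fset_uniq// => i.
    rewrite mem_filter; apply/andP/idP => [[]//|inn]; split => //.
    move: inn; rewrite !in_fset_set; [|exact: finite_box|exact: finite_box].
    by rewrite !inE; exact: sub_box.
  apply: (L1_dist_le_Lnorm p1 (ltW e0)) => //.
  rewrite (_ : (fun w => _) = (fun w => \sum_(i <- s) Z i w)); last exact/funext.
  apply: (le_trans (fsb s us)); rewrite lee_fin.
  have tail : seq_norm 2 s a <= e / D.
    have eD : 0 <= e / D by rewrite divr_ge0// ltW.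
    rewrite /seq_norm [leRHS](_ : _ = ((e / D) `^ 2) `^ 2^-1); last first.
      by rewrite -powRrM mulfV// powRr1.
    apply: ge0_ler_powR; rewrite ?nnegrE ?powR_ge0 ?invr_ge0//.
      by rewrite sumr_ge0// => i _; exact: powR_ge0.
    apply: hF => // i; rewrite mem_filter => /andP[iNn _].
    apply: contra iNn => /FN iN; rewrite in_fset_set; last exact: finite_box.
    by rewrite inE; exact: sub_box iN.
  have tail_p := seq_norm_le s a hp.
  apply: (@le_trans _ _ (C * (e / D * fine T2 + e / D * fine Tp))).
    apply: ler_wpM2l; first exact: ltW.
    apply: lerD; first exact: ler_wpM2r.
    by apply: ler_wpM2r; [exact: Tpr|exact: le_trans tail_p tail].
  rewrite -mulrDr mulrCA -mulrA ler_piMr ?(ltW e0)//.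
  by rewrite ler_pdivrMl// mulr1 lerDl.
have iZS k : P.-integrable setT (EFin \o ZS k).
  apply: (integrable_of_Lnorm p1) => //.
  by apply: (le_lt_trans (fsb _ (fset_uniq _))); rewrite ltry.
have [S iS hS] := L1_complete iZS cauchy.
by exists S; exact: is_L1_sum_of_dist.
Qed.
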